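(* $\mathsf{qh}\text{-}\mathsf{MATLANG}$ and binary q-hierarchical conjunctive queries are equally expressive: (1) for every $\mathsf{qh}\text{-}\mathsf{MATLANG}$ query $\mathbf{Q}$ over a matrix schema $\mathcal{S}$ and every matrix-to-relational schema encoding $\mathrm{Rel}$ on $\mathcal{S}(\mathbf{Q})$ there is a binary q-hierarchical CQ simulating $\mathbf{Q}$ w.r.t. $\mathrm{Rel}$ and well-typed w.r.t. $\mathrm{Rel}^{-1}$; (2) for every binary q-hierarchical CQ $Q$ over a vocabulary $\sigma$ and every relational-to-matrix schema encoding $\mathrm{Mat}$ on $\sigma(Q)$ such that $Q$ is well-typed w.r.t. $\mathrm{Mat}$, there is a $\mathsf{qh}\text{-}\mathsf{MATLANG}$ query simulating $Q$ w.r.t. $\mathrm{Mat}$.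
   Context: Fix a commutative semiring $(K,\oplus,\odot,\mathbb{0},\mathbb{1})$ with $\mathbb{0}\neq\mathbb{1}$. Matrix side: size symbols (incl. $1$), matrix symbols with types, schemas, instances (size symbols to positive integers, $1\mapsto1$; $\mathbf{A}:(\alpha,\beta)$ to $\alpha^{\mathcal{I}}\times\beta^{\mathcal{I}}$ $K$-matrices). Operations: $e^T$ transpose, $\cdot$ matrix product over $K$, $\times$ scalar multiplication by a $(1,1)$ expression, $\odot$ entrywise product, $\mathbf{1}^\alpha$ all-ones vector of type $(\alpha,1)$, $\mathbf{I}^\alpha$ identity of type $(\alpha,\alpha)$; all expressions well-typed. $\mathsf{simple}\text{-}\mathsf{MATLANG}$: $e::=\mathbf{A}\mid\mathbf{1}^\alpha\mid\mathbf{I}^\alpha\mid e^T\mid e_1\times e_2\mid e_1\odot e_2\mid e\cdot\mathbf{1}^\alpha$. $\mathsf{qh}\text{-}\mathsf{MATLANG}$: $e::=e_1\mid e_1\odot(e_2\cdot(\mathbf{1}^\alpha)^T)\mid(\mathbf{1}^\alpha\cdot e_1)\odot e_2\mid(\mathbf{1}^\alpha\cdot e_1)\odot(e_2\cdot(\mathbf{1}^\alpha)^T)$ with $e_1,e_2$ $\mathsf{simple}\text{-}\mathsf{MATLANG}$ expressions. A query $\mathbf{H}:=e$ extends the instance with $\mathbf{H}$ mapped to the value of $e$. Relational side: $K$-relations over $\mathbb{N}_{>0}$ with finite support; databases with constants ($1^{db}=1$). A CQ is $H(\bar x)\leftarrow\exists\bar y.a_1\wedge\dots\wedge a_n$ with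 relational atoms and comparison atoms $x\le c$ under semiring semantics, output $H(\bar d)$ = value on $\bar x\mapsto\bar d$ if $\bar d$ respects repetitions in $\bar x$, else $\mathbb{0}$. Binary: relations of arity $\le2$. For a variable $x$ let $\mathrm{atoms}(x)$ be the set of relational atoms (not comparison atoms) mentioning $x$. The CQ is q-hierarchical if for all variables $x,y$: (i) $\mathrm{atoms}(x)\subseteq\mathrm{atoms}(y)$ or $\mathrm{atoms}(y)\subseteq\mathrm{atoms}(x)$ or $\mathrm{atoms}(x)\cap\mathrm{atoms}(y)=\emptyset$; (ii) if $x$ occurs in $\bar x$ and $\mathrm{atoms}(x)\subsetneq\mathrm{atoms}(y)$ then $y$ occurs in $\bar x$. Encodings and simulation: $\mathrm{Rel}$ is a bijection from the schema onto a vocabulary mapping size symbols to constants ($1\mapsto1$) and matrix symbols to relation symbols of arity $\le2$ (unary only for types $(\alpha,1),(1,\alpha)$, nullary only for $(1,1)$); $\mathrm{Rel}(\mathcal{I})$ stores dimensions in constants and matrix entries in relations ($\mathbb{0}$ outside the dimensions). $\mathrm{Mat}$ is a bijection from a vocabulary onto a schema mapping constants to size symbols ($1\mapsto1$), unary relations to vector types, nullary to $(1,1)$; $db$ is consistent with $\mathrm{Mat}$ if each $R^{db}$ is $\mathbb{0}$ outside the $c^{db}\times d^{db}$ range where $\mathrm{Mat}(R):(\mathrm{Mat}(c),\mathrm{Mat}(d))$; $\mathrm{Mat}(db)$ is the encoded instance. $Q$ simulates $\mathbf{Q}$ w.r.t. $\mathrm{Rel}$ if $\mathrm{Rel}([\![\mathbf{Q}]\!](\mathcal{I}))=[\![Q]\!](\mathrm{Rel}(\mathcal{I}))$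 for all $\mathcal{I}$; $\mathbf{Q}$ simulates $Q$ w.r.t. $\mathrm{Mat}$ if $\mathrm{Mat}([\![Q]\!](db))=[\![\mathbf{Q}]\!](\mathrm{Mat}(db))$ for all $db$ consistent with $\mathrm{Mat}$. Well-typedness $\mathrm{Mat}\vdash\varphi:\tau$: $R(x_1,x_2):\{x_1\mapsto\alpha,x_2\mapsto\beta\}$ if $\mathrm{Mat}(R):(\alpha,\beta)$; $R(x):\{x\mapsto\alpha\}$ if type $(\alpha,1)$ or $(1,\alpha)$; $R():\{\}$; $x\le c:\{x\mapsto\mathrm{Mat}(c)\}$; $\exists$ restricts; $\wedge$ unions agreeing typings. The query is well-typed if additionally $\mathrm{Mat}(H)$ has type $(\tau(x_1),\tau(x_2))$ for head $(x_1,x_2)$, or $(\tau(x),1)$ or $(1,\tau(x))$ for head $(x)$.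
   Formalization: Condition (ii) of q-hierarchical is required only for head variables x with atoms(x) nonempty; read literally, part (1) fails, e.g. for H := (Aᵀ·1^α)×1^β, whose head variable can occur only in comparison atoms. *)

(* Defs.v *)
From Stdlib Require List.
From HB Require Import structures.
From mathcomp Require Import all_boot all_order all_algebra.
From mathcomp Require Import boolp classical_sets functions cardinality fsbigop.

Set Implicit Arguments.
Unset Strict Implicit.
Unset Printing Implicit Defensive.

Import GRing.Theory.

Local Open Scope ring_scope.
Local Open Scope classical_set_scope.

Notation posnat := {n : nat | (0 < n)%N}.

Definition psucc (n : nat) : posnat := exist _ n.+1 isT.
Definition pone : posnat := psucc 0.

Record schema := Schema {
  size_sym : eqType;
  sone : size_sym;
  mat_sym : eqType;
  mrow : mat_sym -> size_sym;
  mcol : mat_sym -> size_sym }.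

Arguments sone {s}.

Record instance (K : comNzSemiRingType) (S : schema) := Instance {
  size_val : size_sym S -> posnat;
  size_val_one : size_val sone = pone;
  mat_val : forall A : mat_sym S,
    'M[K]_(val (size_val (mrow A)), val (size_val (mcol A))) }.

Inductive expr (S : schema) : size_sym S -> size_sym S -> Type :=
| ESym (A : mat_sym S) : expr (mrow A) (mcol A)
| EOnes a : expr a sone
| EId a : expr a a
| ETr a b : expr a b -> expr b a
| EMul a b c : expr a b -> expr b c -> expr a c
| EScale a b : expr sone sone -> expr a b -> expr a b
| EHad a b : expr a b -> expr a b -> expr a b.

Arguments ESym {S} A.
Arguments EOnes {S} a.
Arguments EId {S} a.

Inductive simple_matlang (S : schema) :
    forall a b : size_sym S, expr a b -> Prop :=
| SSym A : simple_matlang (ESym A)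
| SOnes a : simple_matlang (EOnes a)
| SId a : simple_matlang (EId a)
| STr a b (e : expr a b) : simple_matlang e -> simple_matlang (ETr e)
| SScale a b (e1 : expr sone sone) (e2 : expr a b) :
    simple_matlang e1 -> simple_matlang e2 -> simple_matlang (EScale e1 e2)
| SHad a b (e1 e2 : expr a b) :
    simple_matlang e1 -> simple_matlang e2 -> simple_matlang (EHad e1 e2)
| SMulOnes a b (e : expr a b) :
    simple_matlang e -> simple_matlang (EMul e (EOnes b)).

Inductive qh_matlang (S : schema) : forall a b : size_sym S, expr a b -> Prop :=
| QSimple a b (e1 : expr a b) : simple_matlang e1 -> qh_matlang e1
| QRight a b (e1 : expr a b) (e2 : expr a sone) :
    simple_matlang e1 -> simple_matlang e2 ->
    qh_matlang (EHad e1 (EMul e2 (ETr (EOnes b))))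
| QLeft a b (e1 : expr sone b) (e2 : expr a b) :
    simple_matlang e1 -> simple_matlang e2 ->
    qh_matlang (EHad (EMul (EOnes a) e1) e2)
| QBoth a b (e1 : expr sone b) (e2 : expr a sone) :
    simple_matlang e1 -> simple_matlang e2 ->
    qh_matlang (EHad (EMul (EOnes a) e1) (EMul e2 (ETr (EOnes b)))).

Definition first_index (d : posnat) : 'I_(val d) := Ordinal (valP d).

Fixpoint meval (K : comNzSemiRingType) (S : schema) (I : instance K S)
    (a b : size_sym S) (e : expr a b) :
    'M[K]_(val (size_val I a), val (size_val I b)) :=
  match e with
  | ESym A => mat_val I A
  | EOnes _ => const_mx 1
  | EId _ => 1%:M
  | ETr _ _ e => (meval I e)^T
  | EMul _ _ _ e1 e2 => meval I e1 *m meval I e2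
  | EScale _ _ e1 e2 =>
      meval I e1 (first_index (size_val I sone)) (first_index (size_val I sone))
        *: meval I e2
  | EHad _ _ e1 e2 => \matrix_(i, j) (meval I e1 i j * meval I e2 i j)
  end.

(** The schema [S] together with a fresh matrix symbol, [None], of type
    [(a, b)].  A query [H := e] over [S] with [e : expr a b] is represented by
    [e]; its output symbol [H] is the symbol [None] of [ext_schema a b]. *)
Definition ext_schema (S : schema) (a b : size_sym S) : schema :=
  @Schema (size_sym S) sone (option (mat_sym S))
    (fun A => if A is Some A then mrow A else a)
    (fun A => if A is Some A then mcol A else b).

Definition mquery_eval (K : comNzSemiRingType) (S : schema)
    (a b : size_sym S) (e : expr a b) (I : instance K S) :
    instance K (ext_schema a b) :=
  @Instance K (ext_schema a b) (size_val I) (size_val_one I)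
    (fun A => match A return
         'M[K]_(val (size_val I (@mrow (ext_schema a b) A)),
                val (size_val I (@mcol (ext_schema a b) A))) with
       | Some A => mat_val I A
       | None => meval I e
       end).

Record vocabulary := Vocabulary {
  const_sym : eqType;
  cone : const_sym;
  rel_sym : eqType;
  arity : rel_sym -> nat }.

Arguments cone {v}.

Record krel (K : comNzSemiRingType) (k : nat) := KRel {
  krel_fun :> k.-tuple posnat -> K;
  krel_finite : finite_set [set t | krel_fun t != 0] }.

Record database (K : comNzSemiRingType) (V : vocabulary) := Database {
  const_val : const_sym V -> posnat;
  const_one : const_val cone = pone;
  rel_val : forall R : rel_sym V, krel K (arity R) }.

Notation var := nat (only parsing).

Inductive atom (V : vocabulary) :=
| ARel (R : rel_sym V) of (arity R).-tuple var
| ALe of var & const_sym V.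

Definition avars (V : vocabulary) (a : atom V) : seq var :=
  match a with ARel _ t => t | ALe x _ => [:: x] end.

Definition is_rel_atom (V : vocabulary) (a : atom V) : bool :=
  if a is ARel _ _ then true else false.

Inductive formula (V : vocabulary) :=
| FAtom of atom V
| FAnd of formula V & formula V
| FEx of var & formula V.

Fixpoint fvars (V : vocabulary) (f : formula V) : seq var :=
  match f with
  | FAtom a => avars a
  | FAnd f1 f2 => fvars f1 ++ fvars f2
  | FEx y f => [seq x <- fvars f | x != y]
  end.

Definition valuation := var -> posnat.

Definition upd (nu : valuation) (y : var) (d : posnat) : valuation :=
  fun x => if x == y then d else nu x.

Definition atom_sem (K : comNzSemiRingType) (V : vocabulary)
    (db : database K V) (a : atom V) (nu : valuation) : K :=
  match a with
  | ARel R t => rel_val db R (map_tuple nu t)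
  | ALe x c => if (val (nu x) <= val (const_val db c))%N then 1 else 0
  end.

(** The sum in the case of [FEx] is over the finite support of its argument.
    This support is finite whenever the quantified variable is free in the
    quantified formula, see [sem_bounded]; [cq] enforces this condition. *)
Fixpoint sem (K : comNzSemiRingType) (V : vocabulary)
    (db : database K V) (f : formula V) (nu : valuation) : K :=
  match f with
  | FAtom a => atom_sem db a nu
  | FAnd f1 f2 => sem db f1 nu * sem db f2 nu
  | FEx y f => \sum_(d \in [set: posnat]) sem db f (upd nu y d)
  end.

Fixpoint fconj (V : vocabulary) (a : atom V) (s : seq (atom V)) : formula V :=
  if s is b :: s' then FAnd (FAtom a) (fconj b s') else FAtom a.

Definition cq_formula_of (V : vocabulary) (ys : seq var) (a : atom V)
    (s : seq (atom V)) : formula V := foldr (@FEx V) (fconj a s) ys.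

(** [H(head) <- exists exvars, atom1 /\ atoms] with a head of arity [k].  The
    variables of the head, possibly with repetitions, are the free variables of
    the formula, and every quantifier binds a variable of some atom. *)
Record cq (V : vocabulary) (k : nat) := CQ {
  cq_head : k.-tuple var;
  cq_exvars : seq var;
  cq_atom1 : atom V;
  cq_atoms : seq (atom V);
  cq_exvars_uniq : uniq cq_exvars;
  cq_exvars_sub : {subset cq_exvars <= fvars (fconj cq_atom1 cq_atoms)};
  cq_head_free : cq_head =i fvars (cq_formula_of cq_exvars cq_atom1 cq_atoms) }.

Definition cq_body (V : vocabulary) (k : nat) (Q : cq V k) : seq (atom V) :=
  cq_atom1 Q :: cq_atoms Q.

Definition cq_formula (V : vocabulary) (k : nat) (Q : cq V k) : formula V :=
  cq_formula_of (cq_exvars Q) (cq_atom1 Q) (cq_atoms Q).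

Definition respects (k : nat) (xs : k.-tuple var) (d : k.-tuple posnat) :
    bool :=
  [forall i : 'I_k, forall j : 'I_k,
     (tnth xs i == tnth xs j) ==> (tnth d i == tnth d j)].

Definition head_valuation (k : nat) (xs : k.-tuple var) (d : k.-tuple posnat) :
    valuation := fun x => nth pone d (index x xs).

Definition cq_output (K : comNzSemiRingType) (V : vocabulary) (k : nat)
    (Q : cq V k) (db : database K V) (d : k.-tuple posnat) : K :=
  if respects (cq_head Q) d
  then sem db (cq_formula Q) (head_valuation (cq_head Q) d)
  else 0.

Lemma finite_bounded_tuples (k N : nat) (A : set (k.-tuple posnat)) :
  (forall t, A t -> forall d, d \in t -> (val d <= N)%N) -> finite_set A.
Proof.
move=> AN; pose f (t : k.-tuple 'I_N.+1) : k.-tuple posnat :=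
  map_tuple (fun i : 'I_N.+1 => psucc i.-1) t.
apply: (sub_finite_set (B := f @` [set: k.-tuple 'I_N.+1])); last first.
  by apply: finite_image; apply: finite_finset.
move=> t /AN tN; exists (map_tuple (fun d : posnat => inord (val d)) t) => //.
apply: val_inj => /=; rewrite -map_comp -[RHS]map_id.
apply/eq_in_map => d dt /=; apply: val_inj; rewrite /= inordK ?ltnS ?tN//.
by rewrite prednK// (valP d).
Qed.

Lemma krel_bounded (K : comNzSemiRingType) (k : nat) (r : krel K k) :
  exists N, forall t, r t != 0 -> forall d, d \in t -> (val d <= N)%N.
Proof.
case: r => r /= /finite_seqP[s rs].
exists (\max_(t <- s) \max_(d <- tval t) val d) => t rt d dt.
have ts : t \in s by have : [set t | r t != 0] t by []; rewrite rs.
apply: (@leq_trans (\max_(d <- tval t) val d)).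
  by rewrite (big_rem d)//= leq_maxl.
by rewrite [leqRHS](big_rem t)//= leq_maxl.
Qed.

Lemma sem_bounded (K : comNzSemiRingType) (V : vocabulary)
    (db : database K V) (f : formula V) :
  exists N, forall nu, sem db f nu != 0 ->
    forall x, x \in fvars f -> (val (nu x) <= N)%N.
Proof.
elim: f => [[R t|x c]|f1 [N1 IH1] f2 [N2 IH2]|y f [N IH]] /=.
- have [N rN] := krel_bounded (rel_val db R).
  by exists N => nu /rN tN x xt; apply: tN; apply: map_f.
- exists (val (const_val db c)) => nu; case: ifP => [le_c _ z|_]; last first.
    by rewrite eqxx.
  by rewrite inE => /eqP ->.
- exists (maxn N1 N2) => nu nu0 x; rewrite mem_cat leq_max.
  have nu1 : sem db f1 nu != 0.
    by apply: contraNneq nu0 => ->; rewrite mul0r.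
  have nu2 : sem db f2 nu != 0.
    by apply: contraNneq nu0 => ->; rewrite mulr0.
  by move=> /orP[/(IH1 _ nu1)->//|/(IH2 _ nu2)->]; rewrite orbT.
- exists N => nu nu0 x; rewrite mem_filter => /andP[xy xf].
  have [d dn0] : exists d, sem db f (upd nu y d) != 0.
    apply: contrapT => /forallNP all0; move/eqP: nu0; apply.
    by apply: fsbig1 => d _; apply/eqP; apply: contrapT => /negP /all0.
  by have := IH _ dn0 x xf; rewrite /upd (negPf xy).
Qed.

Lemma cq_output_finite (K : comNzSemiRingType) (V : vocabulary) (k : nat)
    (Q : cq V k) (db : database K V) :
  finite_set [set d | cq_output Q db d != 0].
Proof.
have [N semN] := sem_bounded db (cq_formula Q).
apply: (@finite_bounded_tuples _ N) => d /=; rewrite /cq_output.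
case: ifP => [/forallP resp|_]; last by rewrite eqxx.
move=> /semN dN e /tnthP[i ->].
have xh : tnth (cq_head Q) i \in cq_head Q by exact: mem_tnth.
have := dN (tnth (cq_head Q) i); rewrite -cq_head_free => /(_ xh).
rewrite /head_valuation; set j := index _ _.
have jk : (j < k)%N.
  by rewrite -[X in (_ < X)%N](size_tuple (cq_head Q)) index_mem.
have /forallP/(_ (Ordinal jk))/implyP := resp i.
rewrite {1}(tnth_nth 0%N (cq_head Q) (Ordinal jk)) /= nth_index//.
by move=> /(_ (eqxx _))/eqP->; rewrite (tnth_nth pone).
Qed.

Definition cq_result (K : comNzSemiRingType) (V : vocabulary) (k : nat)
    (Q : cq V k) (db : database K V) : krel K k :=
  KRel (cq_output_finite Q db).

(** The vocabulary [V] together with a fresh relation symbol, [None], of arity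
    [k], which is the head symbol of the queries of type [cq V k]. *)
Definition ext_vocabulary (V : vocabulary) (k : nat) : vocabulary :=
  @Vocabulary (const_sym V) cone (option (rel_sym V))
    (fun R => if R is Some R then arity R else k).

Definition cq_eval (K : comNzSemiRingType) (V : vocabulary) (k : nat)
    (Q : cq V k) (db : database K V) : database K (ext_vocabulary V k) :=
  @Database K (ext_vocabulary V k) (const_val db) (const_one db)
    (fun R => match R return krel K (@arity (ext_vocabulary V k) R) with
       | Some R => rel_val db R
       | None => cq_result Q db
       end).

Definition binary (V : vocabulary) (k : nat) (Q : cq V k) : Prop :=
  (k <= 2)%N /\
  forall (R : rel_sym V) (t : (arity R).-tuple var),
    List.In (ARel t) (cq_body Q) -> (arity R <= 2)%N.

Definition atoms (V : vocabulary) (k : nat) (Q : cq V k) (x : var) :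
    set (atom V) :=
  [set a | [/\ List.In a (cq_body Q), is_rel_atom a & x \in avars a]].

(** In the second condition, [x] ranges over the variables that occur in a
    relational atom, as all variables do in queries without comparison atoms.
    Otherwise a head variable that occurs in comparison atoms only would forbid
    any quantified variable in relational atoms, as for [x] in
    [H(x) <- exists y, A(y) /\ x <= c], which expresses [(A . 1) * 1^c]. *)
Definition q_hierarchical (V : vocabulary) (k : nat) (Q : cq V k) : Prop :=
  (forall x y : var,
     [\/ atoms Q x `<=` atoms Q y, atoms Q y `<=` atoms Q x
       | atoms Q x `&` atoms Q y = set0]) /\
  (forall x y : var, x \in cq_head Q -> atoms Q x !=set0 ->
     atoms Q x `<` atoms Q y -> y \in cq_head Q).

Definition arity_compat (S : schema) (a b : size_sym S) (k : nat) : Prop :=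
  match k with
  | 0 => a = sone /\ b = sone
  | 1 => b = sone \/ a = sone
  | 2 => True
  | _ => False
  end.

(** A bijection between a schema and a vocabulary.  The maps [rel_size] and
    [rel_mat] form a matrix-to-relational encoding Rel; the inverse maps
    [mat_const] and [mat_rel] form a relational-to-matrix encoding Mat, and all
    encodings of both kinds are obtained in this way. *)
Record encoding (S : schema) (V : vocabulary) := Encoding {
  rel_size : size_sym S -> const_sym V;
  mat_const : const_sym V -> size_sym S;
  rel_sizeK : cancel rel_size mat_const;
  mat_constK : cancel mat_const rel_size;
  rel_size_one : rel_size sone = cone;
  rel_mat : mat_sym S -> rel_sym V;
  mat_rel : rel_sym V -> mat_sym S;
  rel_matK : cancel rel_mat mat_rel;
  mat_relK : cancel mat_rel rel_mat;
  enc_arity : forall R : rel_sym V,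
    arity_compat (mrow (mat_rel R)) (mcol (mat_rel R)) (arity R) }.

(** The encoding of the schema of a query onto the vocabulary of a query that
    extends [E] and relates the two fresh symbols. *)
Section ExtEncoding.

Context (S : schema) (V : vocabulary) (E : encoding S V).
Context (a b : size_sym S) (k : nat) (abk : arity_compat a b k).

Definition ext_rel_mat (A : mat_sym (ext_schema a b)) :
    rel_sym (ext_vocabulary V k) :=
  omap (rel_mat E) A.

Definition ext_mat_rel (R : rel_sym (ext_vocabulary V k)) :
    mat_sym (ext_schema a b) :=
  omap (mat_rel E) R.

Fact ext_rel_matK : cancel ext_rel_mat ext_mat_rel.
Proof. by case=> [A|] //=; rewrite rel_matK. Qed.

Fact ext_mat_relK : cancel ext_mat_rel ext_rel_mat.
Proof. by case=> [R|] //=; rewrite mat_relK. Qed.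

Fact ext_enc_arity (R : rel_sym (ext_vocabulary V k)) :
  arity_compat (mrow (ext_mat_rel R)) (mcol (ext_mat_rel R)) (arity R).
Proof. by case: R => [R|] /=; [exact: (enc_arity E R)|exact: abk]. Qed.

Definition ext_encoding : encoding (ext_schema a b) (ext_vocabulary V k) :=
  @Encoding (ext_schema a b) (ext_vocabulary V k)
    (rel_size E) (mat_const E) (@rel_sizeK _ _ E) (@mat_constK _ _ E)
    (rel_size_one E) ext_rel_mat ext_mat_rel ext_rel_matK ext_mat_relK
    ext_enc_arity.

End ExtEncoding.

(** The matrix position, counted from [1], denoted by a tuple of a relation
    that encodes a matrix of type [(a, b)], and conversely. *)
Definition position (S : schema) (a b : size_sym S) (t : seq posnat) :
    posnat * posnat :=
  match t with
  | [:: i; j] => (i, j)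
  | [:: i] => if b == sone then (i, pone) else (pone, i)
  | _ => (pone, pone)
  end.

Definition coordinates (S : schema) (a b : size_sym S) (k : nat)
    (i j : posnat) : seq posnat :=
  match k with
  | 0 => [::]
  | 1 => [:: if b == sone then i else j]
  | _ => [:: i; j]
  end.

Definition mx_entry (K : comNzSemiRingType) (m n : nat) (M : 'M[K]_(m, n))
    (p : posnat * posnat) : K :=
  match insub (val p.1).-1, insub (val p.2).-1 with
  | Some i, Some j => M i j
  | _, _ => 0
  end.

Definition krel_at (K : comNzSemiRingType) (k : nat) (r : krel K k)
    (s : seq posnat) : K := if insub s is Some t then r t else 0.

Section Rel.

Context (K : comNzSemiRingType) (S : schema) (V : vocabulary).
Context (E : encoding S V) (I : instance K S).

Definition Rel_fun (R : rel_sym V) (t : (arity R).-tuple posnat) : K :=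
  let A := mat_rel E R in
  mx_entry (mat_val I A) (position (mrow A) (mcol A) t).

Fact Rel_finite (R : rel_sym V) : finite_set [set t | @Rel_fun R t != 0].
Proof.
rewrite /Rel_fun; set A := mat_rel E R.
pose N := maxn (val (size_val I (mrow A))) (val (size_val I (mcol A))).
apply: (@finite_bounded_tuples _ N) => t /=; rewrite /mx_entry.
case: insubP => [i + _|]; last by rewrite eqxx.
case: insubP => [j + _|]; last by rewrite eqxx.
move=> ltj lti _ d dt.
have ub (p : posnat) (m : nat) : ((val p).-1 < m)%N -> (val p <= m)%N.
  by move=> pm; rewrite -(prednK (valP p)).
have := enc_arity E R; rewrite -/A.
have : size t = arity R by rewrite size_tuple.
rewrite -[d \in t]/(d \in tval t) in dt; move: ltj lti dt.
case: (tval t) => [|p [|q [|r s]]] //=; last first.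
- by move=> _ _ _ <-.
- move=> /ub qN /ub pN; rewrite !inE => /orP[]/eqP-> _ _.
    by rewrite leq_max pN.
  by rewrite leq_max qN orbT.
- by case: ifP => _ /ub ltj /ub lti; rewrite inE => /eqP-> _ _;
    rewrite leq_max ?lti ?ltj ?orbT.
Qed.

Fact Rel_const_one : size_val I (mat_const E cone) = pone.
Proof. by rewrite -(rel_size_one E) rel_sizeK size_val_one. Qed.

Definition Rel : database K V :=
  @Database K V (fun c => size_val I (mat_const E c)) Rel_const_one
    (fun R => KRel (Rel_finite R)).

End Rel.

Section Mat.

Context (K : comNzSemiRingType) (S : schema) (V : vocabulary).
Context (E : encoding S V) (db : database K V).

Fact Mat_dim_one : const_val db (rel_size E sone) = pone.
Proof. by rewrite rel_size_one const_one. Qed.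

Definition Mat : instance K S :=
  @Instance K S (fun a => const_val db (rel_size E a)) Mat_dim_one
    (fun A => \matrix_(i, j)
       krel_at (rel_val db (rel_mat E A))
         (coordinates (mrow A) (mcol A) (arity (rel_mat E A))
            (psucc i) (psucc j))).

Definition consistent : Prop :=
  forall (R : rel_sym V) (t : (arity R).-tuple posnat),
    let A := mat_rel E R in
    let p := position (mrow A) (mcol A) t in
    rel_val db R t != 0 ->
    (val p.1 <= val (const_val db (rel_size E (mrow A))))%N /\
    (val p.2 <= val (const_val db (rel_size E (mcol A))))%N.

End Mat.

Definition typing (S : schema) := var -> option (size_sym S).

Definition ty_empty (S : schema) : typing S := fun _ => None.

Definition ty_single (S : schema) (x : var) (a : size_sym S) : typing S :=
  fun z => if z == x then Some a else None.

Definition ty_agree (S : schema) (t1 t2 : typing S) : Prop :=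
  forall x a1 a2, t1 x = Some a1 -> t2 x = Some a2 -> a1 = a2.

Definition ty_union (S : schema) (t1 t2 : typing S) : typing S :=
  fun x => if t1 x is Some a then Some a else t2 x.

Definition ty_remove (S : schema) (t : typing S) (y : var) : typing S :=
  fun x => if x == y then None else t x.

Inductive typed (S : schema) (V : vocabulary) (E : encoding S V) :
    formula V -> typing S -> Prop :=
| TRel2 (R : rel_sym V) (t : (arity R).-tuple var) x1 x2 :
    tval t = [:: x1; x2] ->
    ty_agree (ty_single x1 (mrow (mat_rel E R)))
             (ty_single x2 (mcol (mat_rel E R))) ->
    typed E (FAtom (ARel t))
      (ty_union (ty_single x1 (mrow (mat_rel E R)))
                (ty_single x2 (mcol (mat_rel E R))))
| TRelCol (R : rel_sym V) (t : (arity R).-tuple var) x :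
    tval t = [:: x] -> mcol (mat_rel E R) = sone ->
    typed E (FAtom (ARel t)) (ty_single x (mrow (mat_rel E R)))
| TRelRow (R : rel_sym V) (t : (arity R).-tuple var) x :
    tval t = [:: x] -> mrow (mat_rel E R) = sone ->
    typed E (FAtom (ARel t)) (ty_single x (mcol (mat_rel E R)))
| TRel0 (R : rel_sym V) (t : (arity R).-tuple var) :
    tval t = [::] -> typed E (FAtom (ARel t)) (@ty_empty S)
| TLe x c : typed E (FAtom (ALe x c)) (ty_single x (mat_const E c))
| TEx y f tau : typed E f tau -> typed E (FEx y f) (ty_remove tau y)
| TAnd f1 f2 tau1 tau2 :
    typed E f1 tau1 -> typed E f2 tau2 -> ty_agree tau1 tau2 ->
    typed E (FAnd f1 f2) (ty_union tau1 tau2).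

(** [(a, b)] is the type of the matrix symbol that encodes the head symbol. *)
Definition well_typed (S : schema) (V : vocabulary) (E : encoding S V)
    (a b : size_sym S) (k : nat) (Q : cq V k) : Prop :=
  exists2 tau, typed E (cq_formula Q) tau &
    match tval (cq_head Q) with
    | [:: x1; x2] => tau x1 = Some a /\ tau x2 = Some b
    | [:: x] => (tau x = Some a /\ b = sone) \/ (a = sone /\ tau x = Some b)
    | [::] => a = sone /\ b = sone
    | _ => False
    end.

Definition cq_simulates (K : comNzSemiRingType) (S : schema) (V : vocabulary)
    (E : encoding S V) (a b : size_sym S) (k : nat) (abk : arity_compat a b k)
    (Q : cq V k) (e : expr a b) : Prop :=
  forall I : instance K S,
    Rel (ext_encoding E abk) (mquery_eval e I) = cq_eval Q (Rel E I).

Definition expr_simulates (K : comNzSemiRingType) (S : schema) (V : vocabulary)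
    (E : encoding S V) (a b : size_sym S) (k : nat) (abk : arity_compat a b k)
    (e : expr a b) (Q : cq V k) : Prop :=
  forall db : database K V, consistent E db ->
    Mat (ext_encoding E abk) (cq_eval Q db) = mquery_eval e (Mat E db).

(* Main.v *)
Require Import Defs.
From Stdlib Require List.
From mathcomp Require Import all_boot all_order all_algebra.
From mathcomp Require Import boolp classical_sets functions cardinality fsbigop.

(** Entries are read at positions in [posnat], with value [0] outside the
    dimensions, so that a simulation becomes an identity between the output of
    the query at a tuple and an entry of the value of the expression.

    From expressions to queries: a simple expression of type [(a, b)] with
    [a, b <> 1] is, up to a scalar, a Hadamard product of symbols and
    identities, so its atoms mention either both the row and the column variable
    or neither; one of type [(a, 1)] is a product of factors attached to the row
    variable alone.  A position of type [1] always receives a fresh quantified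
    variable, as otherwise a head variable of type [1] could break the hierarchy.
    Every atom is then contained in a star around a center, and a choice of
    centers that is stable on the head makes the query q-hierarchical.

    From queries to expressions: after dropping the variables of type [1], the
    quantified variables are eliminated one at a time.  The hierarchy always
    provides one that occurs in unary factors only, which is summed out to a
    scalar, or whose factors all mention the same other variable, which is
    summed out by a product with the all-ones vector.  In the end there remain
    scalars, unary factors and binary factors on the head variables, and in the
    presence of binary factors only one of the two head variables may carry
    unary ones. *)

Set Implicit Arguments.
Unset Strict Implicit.
Unset Printing Implicit Defensive.

Import GRing.Theory.

Local Open Scope ring_scope.

(** * Entries of the values of expressions *)

Lemma val_psucc_pred (d : posnat) : psucc (val d).-1 = d.
Proof. by apply: val_inj; rewrite /= prednK// (valP d). Qed.

Lemma posnat_le1 (d : posnat) : (val d <= 1)%N -> d = pone.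
Proof.
move=> d1; apply: val_inj; apply/eqP; rewrite eqn_leq d1 /=.
exact: (valP d).
Qed.

(** Splits a position against a dimension [m]. In range it is literally [psucc i], so that
    [mx_entry_psucc] applies; out of range the entries vanish. *)
Variant posnat_spec (m : nat) (d : posnat) : posnat -> Type :=
| PosnatIn (i : 'I_m) of d = psucc i : posnat_spec m d (psucc i)
| PosnatOut of (m < val d)%N : posnat_spec m d d.

Lemma posnatP (m : nat) (d : posnat) : posnat_spec m d d.
Proof.
case: (leqP (val d) m) => dm; last by constructor.
have lt_dm : ((val d).-1 < m)%N by rewrite prednK// (valP d).
by rewrite -[X in posnat_spec _ _ X]val_psucc_pred;
  apply: (@PosnatIn _ _ (Ordinal lt_dm)); rewrite /= val_psucc_pred.
Qed.

(** Passage from quantifiers, which are finitely supported sums over all positions, to sums over the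
    indices of a matrix. *)
Lemma fsbig_posnat (K : comNzSemiRingType) (N : nat) (F : posnat -> K) :
  (forall d, (N < val d)%N -> F d = 0) ->
  \sum_(d \in [set: posnat]) F d = \sum_(i < N) F (psucc i).
Proof.
move=> F0; pose r := [seq psucc i | i : 'I_N].
rewrite (@fsbigE _ _ _ _ _ r) //; first last.
- move=> d _; case: (posnatP N d) => [i _|/F0 //].
  by move/negP; case; apply/mapP; exists i; rewrite ?mem_enum.
- rewrite map_inj_uniq ?enum_uniq// => i j /(congr1 val) [].
  exact: ord_inj.
rewrite (eq_bigl xpredT) => [|d]; last by rewrite in_setT.
by rewrite /r big_image /=.
Qed.

Section Entries.

Context (K : comNzSemiRingType).

Lemma mx_entry_psucc m n (M : 'M[K]_(m, n)) (i : 'I_m) (j : 'I_n) :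
  mx_entry M (psucc i, psucc j) = M i j.
Proof. by rewrite /mx_entry /= !valK. Qed.

Lemma mx_entry_outl m n (M : 'M[K]_(m, n)) (i j : posnat) :
  (m < val i)%N -> mx_entry M (i, j) = 0.
Proof.
by move=> mi; rewrite /mx_entry /= insubN// -leqNgt -ltnS prednK ?(valP i).
Qed.

Lemma mx_entry_outr m n (M : 'M[K]_(m, n)) (i j : posnat) :
  (n < val j)%N -> mx_entry M (i, j) = 0.
Proof.
move=> nj; rewrite /mx_entry /= (@insubN _ _ _ (val j).-1).
  by case: insub.
by rewrite -leqNgt -ltnS prednK ?(valP j).
Qed.

Context (S : schema) (I : instance K S).

Definition sdim (a : size_sym S) : nat := val (size_val I a).

Definition ent (a b : size_sym S) (e : expr a b) (i j : posnat) : K :=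
  mx_entry (meval I e) (i, j).

Lemma sdim_sone : sdim sone = 1%N.
Proof. by rewrite /sdim size_val_one. Qed.

Lemma sdim_gt0 a : (0 < sdim a)%N. Proof. exact: (valP (size_val I a)). Qed.

Lemma ent_outl a b (e : expr a b) i j : (sdim a < val i)%N -> ent e i j = 0.
Proof. exact: mx_entry_outl. Qed.

Lemma ent_outr a b (e : expr a b) i j : (sdim b < val j)%N -> ent e i j = 0.
Proof. exact: mx_entry_outr. Qed.

Lemma ent_bound a b (e : expr a b) i j : ent e i j != 0 ->
  (val i <= sdim a)%N /\ (val j <= sdim b)%N.
Proof.
move=> e0; split; rewrite leqNgt; apply: contraNN e0 => out; apply/eqP.
  exact: ent_outl.
exact: ent_outr.
Qed.

Lemma ent_tr a b (e : expr a b) i j : ent (ETr e) i j = ent e j i.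
Proof.
case: (posnatP (sdim b) i) => [i0 _|oi]; last by rewrite ent_outl// ent_outr.
case: (posnatP (sdim a) j) => [j0 _|oj]; last by rewrite ent_outr// ent_outl.
by rewrite /ent !mx_entry_psucc mxE.
Qed.

Lemma ent_had a b (e1 e2 : expr a b) i j :
  ent (EHad e1 e2) i j = ent e1 i j * ent e2 i j.
Proof.
case: (posnatP (sdim a) i) => [i0 _|oi]; last by rewrite !ent_outl// mul0r.
case: (posnatP (sdim b) j) => [j0 _|oj]; last by rewrite !ent_outr// mul0r.
by rewrite /ent !mx_entry_psucc mxE.
Qed.

Lemma ent_scale a b (e1 : expr sone sone) (e2 : expr a b) i j :
  ent (EScale e1 e2) i j = ent e1 pone pone * ent e2 i j.
Proof.
case: (posnatP (sdim a) i) => [i0 _|oi]; last first.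
  by rewrite !(ent_outl _ _ oi) mulr0.
case: (posnatP (sdim b) j) => [j0 _|oj]; last first.
  by rewrite !(ent_outr _ _ oj) mulr0.
rewrite /ent !mx_entry_psucc mxE.
by congr (_ * _); rewrite -mx_entry_psucc.
Qed.

Lemma ent_ones a i j :
  ent (EOnes a) i j = ((val i <= sdim a) && (val j <= 1))%N%:R.
Proof.
case: (posnatP (sdim a) i) => [i0 _|oi]; last first.
  by rewrite ent_outl// leqNgt oi.
case: (posnatP (sdim sone) j) => [j0 _|oj]; last first.
  rewrite ent_outr//; move: oj; rewrite sdim_sone => oj.
  by rewrite [X in _ && X]leqNgt oj andbF.
rewrite /ent !mx_entry_psucc mxE /= ltn_ord.
by case: j0 => j0 /=; rewrite sdim_sone => ->.
Qed.

Lemma ent_id a i j : ent (EId a) i j = ((val i <= sdim a)%N && (i == j))%:R.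
Proof.
case: (posnatP (sdim a) i) => [i0 _|oi]; last first.
  by rewrite ent_outl// leqNgt oi.
case: (posnatP (sdim a) j) => [j0 _|oj].
  by rewrite /ent !mx_entry_psucc mxE /= ltn_ord.
rewrite ent_outr//; case: eqP => [ij|_]; last by rewrite andbF.
by move: oj; rewrite -ij ltnNge /= ltn_ord.
Qed.

Lemma ent_mul a b c (e1 : expr a b) (e2 : expr b c) i j :
  ent (EMul e1 e2) i j = \sum_(d < sdim b) ent e1 i (psucc d) * ent e2 (psucc d) j.
Proof.
case: (posnatP (sdim a) i) => [i0 _|oi]; last first.
  by rewrite ent_outl// big1// => d _; rewrite ent_outl// mul0r.
case: (posnatP (sdim c) j) => [j0 _|oj]; last first.
  by rewrite ent_outr// big1// => d _; rewrite (ent_outr _ _ oj) mulr0.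
rewrite /ent mx_entry_psucc mxE; apply: eq_bigr => d _.
by rewrite !mx_entry_psucc.
Qed.

Lemma ent_mul_ones a b (e : expr a b) i j :
  ent (EMul e (EOnes b)) i j =
  (\sum_(d < sdim b) ent e i (psucc d)) * (val j <= 1)%N%:R.
Proof.
rewrite ent_mul big_distrl; apply: eq_bigr => d _ /=.
by rewrite ent_ones /= ltn_ord.
Qed.

Lemma ent_ones_mul a b (e : expr sone b) i j :
  ent (EMul (EOnes a) e) i j = (val i <= sdim a)%N%:R * ent e pone j.
Proof.
rewrite ent_mul sdim_sone big_ord1 ent_ones andbT.
by rewrite (_ : psucc _ = pone).
Qed.

Lemma ent_mul_ones_tr a b (e : expr a sone) i j :
  ent (EMul e (ETr (EOnes b))) i j = ent e i pone * (val j <= sdim b)%N%:R.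
Proof.
rewrite ent_mul sdim_sone big_ord1 ent_tr ent_ones andbT.
by rewrite (_ : psucc _ = pone).
Qed.

End Entries.

(** * Typed sums and the semantics of formulas *)

Lemma upd_comm (nu : valuation) x y d d' : x != y ->
  upd (upd nu x d) y d' = upd (upd nu y d') x d.
Proof.
move=> xy; apply: funext => z; rewrite /upd.
by case: (eqVneq z y) => [->|//]; rewrite eq_sym (negPf xy).
Qed.

Lemma upd_neq (nu : valuation) y d x : x != y -> upd nu y d x = nu x.
Proof. by rewrite /upd => /negPf->. Qed.

Lemma upd_eq (nu : valuation) y d : upd nu y d y = d.
Proof. by rewrite /upd eqxx. Qed.

(** Semantic substitute for having all free variables in [X]; it also applies to products of atoms
    and to partially summed functions. *)
Definition depends_on (T : Type) (X : seq nat) (F : valuation -> T) : Prop :=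
  forall nu nu', {in X, nu =1 nu'} -> F nu = F nu'.

Lemma depends_onW T (X Y : seq nat) (F : valuation -> T) :
  {subset X <= Y} -> depends_on X F -> depends_on Y F.
Proof. by move=> XY XF nu nu' eqY; apply: XF => x /XY /eqY. Qed.

Section TypedSums.

Context (K : comNzSemiRingType) (S : schema) (I : instance K S).

(** Typed counterpart of a block of [FEx]: each variable ranges over the finite dimension of its
    type, so that sums can be exchanged and distributed freely. [sem_exists] links the two. *)
Fixpoint tsum (tau : nat -> size_sym S) (ys : seq nat) (F : valuation -> K)
    (nu : valuation) : K :=
  if ys is y :: ys' then
    \sum_(d < sdim I (tau y)) tsum tau ys' F (upd nu y (psucc d))
  else F nu.

Lemma eq_tsum_typing tau tau' ys F nu :
  {in ys, tau =1 tau'} -> tsum tau ys F nu = tsum tau' ys F nu.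
Proof.
elim: ys nu => //= y ys IH nu eqt; rewrite eqt ?mem_head//.
by apply: eq_bigr => d _; apply: IH => x xy; rewrite eqt// inE xy orbT.
Qed.

Context (tau : nat -> size_sym S).

(** Every variable is constrained, occurring or not, which avoids tracking the free variables of the
    functions that are compared. The default [pone] of [head_valuation] makes the condition
    attainable. *)
Definition in_dims (nu : valuation) : Prop :=
  forall x, (val (nu x) <= sdim I (tau x))%N.

Lemma in_dims_upd nu y (d : 'I_(sdim I (tau y))) :
  in_dims nu -> in_dims (upd nu y (psucc d)).
Proof.
move=> nud x; case: (eqVneq x y) => [->|xy]; last by rewrite upd_neq.
by rewrite upd_eq /= ltn_ord.
Qed.

Lemma eq_tsum_in ys F G nu : in_dims nu ->
  (forall nu', in_dims nu' -> F nu' = G nu') ->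
  tsum tau ys F nu = tsum tau ys G nu.
Proof.
move=> + FG; elim: ys nu => [|y ys IH] nu nud /=; first exact: FG.
by apply: eq_bigr => d _; apply: IH; apply: in_dims_upd.
Qed.

Lemma eq_tsum ys F G nu : F =1 G -> tsum tau ys F nu = tsum tau ys G nu.
Proof. by move=> /funext->. Qed.

Lemma tsum_depends_on ys X F :
  depends_on (ys ++ X) F -> depends_on X (tsum tau ys F).
Proof.
elim: ys X => [|y ys IH] X XF //= nu nu' eqX; apply: eq_bigr => d _.
apply: (IH (y :: X)).
  apply: depends_onW XF => z; rewrite !(inE, mem_cat).
  by rewrite orbCA.
move=> z; rewrite inE /upd; case: eqP => //= _; exact: eqX.
Qed.

(** Merging two quantifier blocks without capture: neither block binds a variable on which the other
    factor depends, so each sum treats the other factor as a constant and distributivity applies. *)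
Lemma tsum_mul ys1 ys2 X1 X2 F G nu :
  depends_on X1 F -> depends_on X2 G ->
  ~~ has (mem X2) ys1 -> ~~ has (mem X1) ys2 ->
  tsum tau (ys1 ++ ys2) (fun nu => F nu * G nu) nu =
  tsum tau ys1 F nu * tsum tau ys2 G nu.
Proof.
move=> FX GX; have GX2 : depends_on X2 (tsum tau ys2 G).
  apply: tsum_depends_on; apply: depends_onW GX => x xX.
  by rewrite mem_cat xX orbT.
have upd_in X y (mu : valuation) d : y \notin X -> {in X, upd mu y d =1 mu}.
  by move=> yX x xX; rewrite upd_neq//; apply: contraNneq yX => <-.
elim: ys1 nu => [|y ys1 IH] nu /=.
  move=> _; elim: ys2 nu {GX2} => [|y ys2 IH] nu //=; rewrite negb_or.
  move=> /andP[yX hX]; rewrite big_distrr /=; apply: eq_bigr => d _.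
  by rewrite IH//; congr (_ * _); apply: FX; apply: upd_in.
rewrite negb_or => /andP[yX hX1] hX2; rewrite big_distrl /=.
apply: eq_bigr => d _; rewrite IH//; congr (_ * _).
by apply: GX2; apply: upd_in.
Qed.

Lemma tsum_inner ys y F nu : y \notin ys ->
  \sum_(d < sdim I (tau y)) tsum tau ys F (upd nu y (psucc d)) =
  tsum tau ys (fun nu => \sum_(d < sdim I (tau y)) F (upd nu y (psucc d))) nu.
Proof.
elim: ys nu => //= z ys IH nu; rewrite inE negb_or => /andP[yz yys].
rewrite exchange_big /=; apply: eq_bigr => d _; rewrite -IH//.
by apply: eq_bigr => d' _; rewrite upd_comm.
Qed.

(** Any variable of a block can be made innermost. The elimination below may thus follow the order
    dictated by the hierarchy instead of that of the quantifiers. *)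
Lemma tsum_rem ys y F nu : uniq ys -> y \in ys ->
  tsum tau ys F nu =
  tsum tau (rem y ys) (fun nu => \sum_(d < sdim I (tau y)) F (upd nu y (psucc d))) nu.
Proof.
elim: ys nu => //= z ys IH nu /andP[zys uys]; rewrite inE eq_sym.
have [<-|zy] /= := eqVneq z y; first by move=> _; rewrite tsum_inner.
by move=> yys; apply: eq_bigr => d _; rewrite IH.
Qed.

Lemma tsum_neq0 ys F nu : tsum tau ys F nu != 0 ->
  exists2 nu', F nu' != 0 & forall x, x \notin ys -> nu' x = nu x.
Proof.
elim: ys nu => [|y ys IH] nu /= nz; first by exists nu.
have [d dnz] : exists d : 'I_(sdim I (tau y)),
    tsum tau ys F (upd nu y (psucc d)) != 0.
  apply: contrapT => /forallNP all0; move/eqP: nz; apply.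
  by apply: big1 => d _; apply/eqP; apply: contrapT => /negP /all0.
have [nu' nz' eqnu'] := IH _ dnz; exists nu' => // x.
by rewrite inE negb_or => /andP[xy xys]; rewrite eqnu'// upd_neq.
Qed.

End TypedSums.

Section Formulas.

Context (K : comNzSemiRingType) (S : schema) (V : vocabulary).

Definition avars_of (s : seq (atom V)) : seq nat := flatten (map (@avars V) s).

Lemma avars_ofP (s : seq (atom V)) x :
  x \in avars_of s <-> exists2 a, List.In a s & x \in avars a.
Proof.
elim: s => [|a s IH]; first by split=> // -[].
rewrite /avars_of /= mem_cat; split=> [/orP[xa|/IH[b bs xb]]|[b [<-|bs] xb]].
- by exists a => //; left.
- by exists b => //; right.
- by rewrite xb.
- by apply/orP; right; apply/IH; exists b.
Qed.

Lemma avars_of_cat (s1 s2 : seq (atom V)) :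
  avars_of (s1 ++ s2) = avars_of s1 ++ avars_of s2.
Proof. by rewrite /avars_of map_cat flatten_cat. Qed.

Lemma fvars_fconj (a : atom V) s : fvars (fconj a s) = avars_of (a :: s).
Proof.
elim: s a => [|b s IH] a /=; first by rewrite /avars_of /= cats0.
by rewrite IH.
Qed.

Lemma mem_fvars_ex (f : formula V) ys x :
  (x \in fvars (foldr (@FEx V) f ys)) = (x \notin ys) && (x \in fvars f).
Proof.
elim: ys => //= y ys IH; rewrite mem_filter IH inE negb_or andbA.
by [].
Qed.

Lemma sem_fconj (db : database K V) a s nu :
  sem db (fconj a s) nu = \prod_(b <- a :: s) atom_sem db b nu.
Proof.
elim: s a => [|b s IH] a; first by rewrite big_seq1.
by rewrite big_cons /= IH.
Qed.

Lemma atom_sem_depends_on (db : database K V) a :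
  depends_on (avars a) (atom_sem db a).
Proof.
case: a => [R t|x c] nu nu' eqnu /=.
  congr (rel_val db R _); apply: val_inj => /=.
  by apply/eq_in_map => x /eqnu.
by rewrite eqnu ?mem_head.
Qed.

Lemma prod_atom_sem_depends_on (db : database K V) s :
  depends_on (avars_of s) (fun nu => \prod_(b <- s) atom_sem db b nu).
Proof.
move=> nu nu'; elim: s => [|a s IH]; first by rewrite !big_nil.
rewrite !big_cons /avars_of /= => eqs; congr (_ * _).
  by apply: atom_sem_depends_on => x xa; rewrite eqs// mem_cat xa.
by apply: IH => x xs; rewrite eqs// mem_cat xs orbT.
Qed.

Lemma prod_atom_sem_neq0 (db : database K V) s nu :
  \prod_(b <- s) atom_sem db b nu != 0 ->
  forall b, List.In b s -> atom_sem db b nu != 0.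
Proof.
elim: s => [|a s IH] //; rewrite big_cons => nz b [<-|bs].
  by apply: contraNneq nz => ->; rewrite mul0r.
by apply: IH => //; apply: contraNneq nz => ->; rewrite mulr0.
Qed.

(** If [f] vanishes as soon as a quantified variable leaves its dimension, cutting every sum at that
    dimension loses nothing. *)
Lemma sem_exists (I : instance K S) tau (db : database K V) f ys nu :
  uniq ys ->
  (forall nu, sem db f nu != 0 ->
     forall y, y \in ys -> (val (nu y) <= sdim I (tau y))%N) ->
  sem db (foldr (@FEx V) f ys) nu = tsum I tau ys (sem db f) nu.
Proof.
elim: ys nu => //= y ys IH nu /andP[yys uys] fnz.
have fnz' nu' : sem db f nu' != 0 ->
    forall y', y' \in ys -> (val (nu' y') <= sdim I (tau y'))%N.
  by move=> nz y' y'ys; apply: fnz => //; rewrite inE y'ys orbT.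
rewrite (@fsbig_posnat _ (sdim I (tau y))) => [|d dout].
  by apply: eq_bigr => d _; exact: IH.
(* A nonzero remaining sum would have a nonzero term; since [y] is not bound again in [ys], that
   term still gives [y] the value [d] beyond its dimension. *)
rewrite IH//; apply/eqP; apply: contrapT => /negP nz.
have [nu' nz' eqnu'] := tsum_neq0 nz.
have := fnz _ nz' _ (mem_head _ _); rewrite eqnu'// upd_eq.
by rewrite leqNgt dout.
Qed.

End Formulas.

(** * Well-typedness and the bounds that it puts on valuations *)

Section Typing.

Context (K : comNzSemiRingType) (S : schema) (V : vocabulary).
Context (E : encoding S V).

(** Typing of an atom under an ambient typing that may cover further variables. Being monotone in
    [tau], it can be pushed through conjunctions and quantifiers, whereas [typed] prescribes the
    exact domain. *)
Definition atom_typed (tau : typing S) (a : atom V) : Prop :=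
  match a with
  | ARel R t => let A := mat_rel E R in
      match tval t with
      | [:: x; y] => tau x = Some (mrow A) /\ tau y = Some (mcol A)
      | [:: x] => (mcol A = sone /\ tau x = Some (mrow A)) \/
                  (mrow A = sone /\ tau x = Some (mcol A))
      | [::] => mrow A = sone /\ mcol A = sone
      | _ => False
      end
  | ALe x c => tau x = Some (mat_const E c)
  end.

Definition ty_sub (t1 t2 : typing S) : Prop :=
  forall x c, t1 x = Some c -> t2 x = Some c.

Lemma atom_typedW t1 t2 a : ty_sub t1 t2 -> atom_typed t1 a -> atom_typed t2 a.
Proof.
move=> t12; case: a => [R t|x c] /=; last exact: t12.
case: (tval t) => [|x [|y [|]]] //.
  by case=> [[-> /t12 ->]|[-> /t12 ->]]; [left|right].
by case=> /t12-> /t12->.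
Qed.

Lemma typed_atom tau f : typed E f tau ->
  if f is FAtom a then atom_typed tau a else True.
Proof.
case=> //.
- move=> R t x y tE xy /=; rewrite tE /= /ty_union /ty_single eqxx; split=> //.
  have := xy y; rewrite /ty_single; rewrite eqxx.
  by case: (eqVneq y x) => // _ /(_ _ _ erefl erefl) ->.
- by move=> R t x tE c1 /=; rewrite tE /ty_single eqxx; left.
- by move=> R t x tE c1 /=; rewrite tE /ty_single eqxx; right.
(* The rule for nullary atoms is silent on the type of the symbol; [enc_arity] forces it to be
   [(sone, sone)]. *)
- move=> R t tE /=; rewrite tE; have := enc_arity E R.
  by have := size_tuple t; rewrite tE /= => <-.
- by move=> x c /=; rewrite /ty_single eqxx.
Qed.

Lemma typed_and tau f : typed E f tau ->
  if f is FAnd f1 f2 then exists tau1 tau2,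
    [/\ typed E f1 tau1, typed E f2 tau2, ty_sub tau1 tau & ty_sub tau2 tau]
  else True.
Proof.
case=> // f1 f2 tau1 tau2 f1t f2t agr; exists tau1, tau2; split=> //.
  by move=> x c; rewrite /ty_union => ->.
move=> x c t2; rewrite /ty_union; case t1: (tau1 x) => [c'|//].
by rewrite (agr _ _ _ t1 t2).
Qed.

Lemma typed_ex tau f : typed E f tau ->
  if f is FEx y f then exists2 tau', typed E f tau' & ty_sub tau tau' else True.
Proof.
case=> // y f' tau' f't; exists tau' => // x c.
by rewrite /ty_remove; case: eqP.
Qed.

Lemma typed_fconj tau a s : typed E (fconj a s) tau ->
  forall b, List.In b (a :: s) -> atom_typed tau b.
Proof.
elim: s a tau => [|a' s IH] a tau /=.
  by move=> /typed_atom at_ b [<-|].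
move=> /typed_and[tau1 [tau2 [/typed_atom t1 t2 s1 s2]]] b [<-|bs].
  exact: atom_typedW t1.
by apply: atom_typedW s2 _; apply: IH t2 _ _.
Qed.

Lemma typed_foldr_ex tau f ys : typed E (foldr (@FEx V) f ys) tau ->
  exists2 tau', typed E f tau' & ty_sub tau tau'.
Proof.
elim: ys tau => [|y ys IH] tau /=; first by exists tau.
move=> /typed_ex[tau1 /IH[tau2 t2 s2] s1]; exists tau2 => // x c /s1.
exact: s2.
Qed.

(** Since [typed] determines its typing as a function, the total [tau] is cut down to the variables
    of the atom and matched with the rule by extensionality. *)
Lemma atom_typed_typed (tau : nat -> size_sym S) a :
  atom_typed (Some \o tau) a ->
  typed E (FAtom a) (fun x => if x \in avars a then Some (tau x) else None).
Proof.
case: a => [R t|x c] /=.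
  case tE: (tval t) => [|x [|y [|]]] //=.
  - move=> _; rewrite (_ : (fun _ => _) = @ty_empty S); first exact: TRel0.
    by apply: funext.
  - case=> -[A1 [tx]].
      rewrite (_ : (fun _ => _) = ty_single x (mrow (mat_rel E R))).
        exact: TRelCol.
      apply: funext => z; rewrite inE /ty_single.
      by case: eqP => // ->; rewrite tx.
    rewrite (_ : (fun _ => _) = ty_single x (mcol (mat_rel E R))).
      exact: TRelRow.
    apply: funext => z; rewrite inE /ty_single.
    by case: eqP => // ->; rewrite tx.
  - case=> -[tx] [ty].
    rewrite (_ : (fun _ => _) = ty_union (ty_single x (mrow (mat_rel E R)))
                (ty_single y (mcol (mat_rel E R)))).
      apply: TRel2 => // z c1 c2; rewrite /ty_single -tx -ty.
      by case: eqP => // -> [<-]; case: eqP => // -> [].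
    apply: funext => z; rewrite !inE.
    rewrite /ty_union /ty_single.
    case: eqP => [->|_] /=; first by rewrite tx.
    by case: eqP => [->|//]; rewrite ty.
move=> [tx]; rewrite (_ : (fun _ => _) = ty_single x (mat_const E c)).
  exact: TLe.
by apply: funext => z; rewrite inE /ty_single; case: eqP => // ->; rewrite tx.
Qed.

Lemma fconj_typed (tau : nat -> size_sym S) a s :
  (forall b, List.In b (a :: s) -> atom_typed (Some \o tau) b) ->
  typed E (fconj a s)
    (fun x => if x \in fvars (fconj a s) then Some (tau x) else None).
Proof.
elim: s a => [|b s IH] a abt; first by apply: atom_typed_typed; apply: abt; left.
have ta : atom_typed (Some \o tau) a by apply: abt; left.
have ts := IH b (fun c cs => abt c (or_intror cs)).
have := TAnd (atom_typed_typed ta) ts.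
rewrite (_ : ty_union _ _ = (fun x => if x \in fvars (fconj a (b :: s))
  then Some (tau x) else None)).
  by apply => x c1 c2; case: ifP => // _ [<-]; case: ifP => // _ [<-].
apply: funext => x; rewrite /ty_union [fvars (fconj a _)]/= mem_cat.
by case: (x \in avars a).
Qed.

Lemma foldr_ex_typed f tau ys : typed E f tau ->
  typed E (foldr (@FEx V) f ys) (fun x => if x \in ys then None else tau x).
Proof.
move=> ft; elim: ys => [|y ys IH] //=.
rewrite (_ : (fun _ => _) =
  ty_remove (fun x => if x \in ys then None else tau x) y); first exact: TEx.
by apply: funext => x; rewrite /ty_remove inE; case: eqP.
Qed.

Context (I : instance K S).

Lemma atom_sem_Rel2 (R : rel_sym V) (t : (arity R).-tuple nat) x y nu :
  tval t = [:: x; y] ->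
  atom_sem (Rel E I) (ARel t) nu = ent I (ESym (mat_rel E R)) (nu x) (nu y).
Proof. by move=> tE; rewrite /= /Rel_fun /= tE. Qed.

Lemma atom_sem_Rel1 (R : rel_sym V) (t : (arity R).-tuple nat) x nu :
  tval t = [:: x] ->
  atom_sem (Rel E I) (ARel t) nu = if mcol (mat_rel E R) == sone
    then ent I (ESym (mat_rel E R)) (nu x) pone
    else ent I (ESym (mat_rel E R)) pone (nu x).
Proof. by move=> tE; rewrite /= /Rel_fun /= tE /=; case: ifP. Qed.

Lemma atom_sem_Rel0 (R : rel_sym V) (t : (arity R).-tuple nat) nu :
  tval t = [::] ->
  atom_sem (Rel E I) (ARel t) nu = ent I (ESym (mat_rel E R)) pone pone.
Proof. by move=> tE; rewrite /= /Rel_fun /= tE. Qed.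

Lemma atom_sem_Le x c nu :
  atom_sem (Rel E I) (ALe x c) nu = (val (nu x) <= sdim I (mat_const E c))%N%:R.
Proof. by rewrite /=; case: ifP. Qed.

(** Entries vanish outside the dimensions and a comparison atom bounds its variable by the dimension
    of its type. This discharges the support condition of [sem_exists]. *)
Lemma atom_typed_bound (tau : nat -> size_sym S) a nu :
  atom_typed (Some \o tau) a -> atom_sem (Rel E I) a nu != 0 ->
  forall x, x \in avars a -> (val (nu x) <= sdim I (tau x))%N.
Proof.
case: a => [R t|x c]; last first.
  move=> /= [<-]; case: ifP => [le_x _ z|_]; last by rewrite eqxx.
  by rewrite inE => /eqP->.
rewrite [atom_typed _ _]/=; case tE: (tval t) => [|x [|y [|]]] //.
- by move=> _ _ x; rewrite -[_ \in _]/(x \in tval t) tE.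
- rewrite (atom_sem_Rel1 _ tE) => tx nz z.
  rewrite -[_ \in _]/(z \in tval t) tE inE => /eqP->; move: tx nz.
  case=> -[s1] [->].
    by move/eqP: s1 => -> /ent_bound[].
  (* A symbol of type [(sone, sone)] is read as a column even when the typing treats it as a row;
     both dimensions are then the same. *)
  case: (mcol _ =P sone) => [s1'|_] /ent_bound[] //.
  by rewrite s1 s1'.
- rewrite (atom_sem_Rel2 _ tE) => -[[tx] [ty]] /ent_bound[bx by_] z.
  rewrite -[_ \in _]/(z \in tval t) tE !inE => /orP[]/eqP->.
    by rewrite tx.
  by rewrite ty.
Qed.

End Typing.

(** * A pointwise condition that implies both notions of simulation *)

Section Simulation.

Context (K : comNzSemiRingType) (S : schema) (V : vocabulary).
Context (E : encoding S V).

Lemma krel_ext k (r1 r2 : krel K k) : r1 =1 r2 -> r1 = r2.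
Proof.
case: r1 r2 => [f1 p1] [f2 p2] /= /funext f12; move: p1; rewrite f12 => p1.
by congr KRel; apply: Prop_irrelevance.
Qed.

Lemma database_ext (W : vocabulary) (d1 d2 : database K W) :
  const_val d1 =1 const_val d2 ->
  (forall R t, rel_val d1 R t = rel_val d2 R t) -> d1 = d2.
Proof.
case: d1 d2 => [c1 p1 r1] [c2 p2 r2] /= /funext c12 r12; move: p1.
rewrite c12 => p1; have -> : r1 = r2.
  by apply: functional_extensionality_dep => R; apply: krel_ext => t; exact: r12.
by congr Database; apply: Prop_irrelevance.
Qed.

Lemma position_coordinates (a b : size_sym S) k (t : k.-tuple posnat) :
  (k <= 2)%N ->
  coordinates a b k (position a b t).1 (position a b t).2 = t.
Proof.
case: t => s /= /eqP; case: s => [|x [|y [|? ?]]] /= <- //= _.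
by case: (b == sone).
Qed.

Lemma arity_compat_le2 (a b : size_sym S) k : arity_compat a b k -> (k <= 2)%N.
Proof. by case: k => [|[|[|]]]. Qed.

Lemma krel_at_tuple k (r : krel K k) (t : k.-tuple posnat) : krel_at r t = r t.
Proof. by rewrite /krel_at valK. Qed.

(** Decoding into matrices only forgets what lies outside the dimensions, and consistency makes that
    part zero. Simulation over consistent databases hence reduces to simulation over encoded
    instances. *)
Lemma Rel_Mat (db : database K V) : consistent E db -> Rel E (Mat E db) = db.
Proof.
move=> con; apply: database_ext => [c|R t] /=; first by rewrite mat_constK.
rewrite /Rel_fun /=.
have := con R t; set A := mat_rel E R => /=.
have := position_coordinates (mrow A) (mcol A) t (arity_compat_le2 (enc_arity E R)).
case: (position (mrow A) (mcol A) t) => i j /= ijt conR.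
have out : ~ ((val i <= val (const_val db (rel_size E (mrow A))))%N /\
    (val j <= val (const_val db (rel_size E (mcol A))))%N) ->
  0 = rel_val db R t.
  by move=> nin; apply/esym/eqP; apply: contrapT => /negP/conR.
move: ijt out.
case: (posnatP (val (const_val db (rel_size E (mrow A)))) i) => [i0 _|oi]; last first.
  move=> _ <-; first by rewrite mx_entry_outl.
  by case=> + _; rewrite leqNgt oi.
case: (posnatP (val (const_val db (rel_size E (mcol A)))) j) => [j0 _|oj]; last first.
  move=> _ <-; first by rewrite mx_entry_outr.
  by case=> _; rewrite leqNgt oj.
move=> ijt _; rewrite mx_entry_psucc mxE.
have AR : rel_mat E A = R by exact: mat_relK.
by rewrite AR ijt krel_at_tuple.
Qed.

Context (a b : size_sym S) (k : nat) (abk : arity_compat a b k).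
Context (Q : cq V k) (e : expr a b).

(** Common target of both directions: it gives [cq_simulates] by extensionality and [expr_simulates]
    after replacing [db] by [Rel E (Mat E db)]. *)
Definition entry_simulates : Prop := forall (I : instance K S) t,
  cq_output Q (Rel E I) t =
  ent I e (position a b t).1 (position a b t).2.

Lemma entry_cq_simulates : entry_simulates -> cq_simulates K E abk Q e.
Proof.
move=> sim I; apply: database_ext => // -[R|] t //.
by rewrite [RHS]sim /ent -surjective_pairing.
Qed.

Lemma entry_expr_simulates : entry_simulates -> expr_simulates K E abk e Q.
Proof.
move=> sim db con; rewrite /Mat /mquery_eval /=; congr Instance.
  exact: Prop_irrelevance.
apply: functional_extensionality_dep => -[A|] //=.
apply/matrixP => i j; rewrite mxE.
have szk : size (coordinates a b k (psucc i) (psucc j)) == k.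
  by case: k abk => [|[|[|]]].
rewrite -[coordinates _ _ _ _ _]/(tval (Tuple szk)) krel_at_tuple /=.
rewrite -{1}(Rel_Mat con) sim /= -mx_entry_psucc /ent; congr mx_entry.
(* Tuples of arity below two drop coordinates, which [position] restores as [pone]; this is right
   because a dimension of type [sone] has a single index. *)
have one (n : 'I_(sdim (Mat E db) sone)) : psucc n = pone.
  by case: n => n /=; rewrite sdim_sone; case: n.
rewrite {sim szk}; move: i j; rewrite /coordinates.
case: k abk => [[a1 b1]|[ab1|[ab1|//]]] i j //=.
  move: i j; rewrite a1 b1 => i j.
  by rewrite (one i) (one j).
case: eqP => [b1|nb1] /=.
  by move: j; rewrite b1 => j; rewrite (one j).
case: ab1 => // a1.
by move: i; rewrite a1 => i; rewrite (one i).
Qed.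

End Simulation.

(** * From expressions to queries *)

(** All relational atoms of [x] mention [c x], so the atoms of [x] are among those of its center,
    and two variables sharing an atom are comparable because one is the center of the other. For the
    head condition, a strict inclusion leaves only [y = c x], as [c y = x] would give the reverse
    inclusion. *)
Lemma star_q_hierarchical (V : vocabulary) k (Q : cq V k) (c : nat -> nat) :
  (forall a, List.In a (cq_body Q) -> is_rel_atom a ->
     (forall x, x \in avars a -> c x \in avars a) /\
     (forall x y, x \in avars a -> y \in avars a -> x != y ->
        c x = y \/ c y = x)) ->
  (forall x, x \in cq_head Q -> c x \in cq_head Q) ->
  q_hierarchical Q.
Proof.
move=> star chead.
have sub x : (atoms Q x `<=` atoms Q (c x))%classic.
  move=> a [aQ ra xa]; split=> //.
  by have [+ _] := star _ aQ ra; apply.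
split=> [x y|x y xh [a ax] [xy nyx]].
  have [<-|xy] := eqVneq x y; first exact: Or31.
  have [cxy|cxy] := eqVneq (c x) y; first by apply: Or31; rewrite -cxy.
  have [cyx|cyx] := eqVneq (c y) x; first by apply: Or32; rewrite -cyx.
  apply: Or33; rewrite -subset0 => a [[aQ ra xa] [_ _ ya]].
  have [_ /(_ _ _ xa ya xy)] := star _ aQ ra.
  by case=> [/eqP|/eqP]; apply/negP.
have [yx|nxy] := eqVneq x y; first by rewrite -yx.
have [aQ ra xa] := ax; have [_ _ ya] := xy _ ax.
have [_ /(_ _ _ xa ya nxy)] := star _ aQ ra.
case=> [<-|cyx]; first exact: chead.
by case: nyx; rewrite -cyx.
Qed.

Lemma respects_uniq k (xs : k.-tuple nat) (d : k.-tuple posnat) :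
  uniq xs -> respects xs d.
Proof.
move=> uxs; apply/forallP => i; apply/forallP => j; apply/implyP.
by move=> /eqP /(tuple_uniqP _ uxs) ->.
Qed.

Lemma respects_diag (xs : 2.-tuple nat) (d : 2.-tuple posnat) x i j :
  tval xs = [:: x; x] -> tval d = [:: i; j] -> respects xs d = (i == j).
Proof.
move=> xsE dE; apply/forallP/eqP => [/(_ ord0)/forallP/(_ ord_max)|ij i1].
  rewrite !(tnth_nth pone, tnth_nth 0%N) xsE dE /= eqxx.
  by move=> /eqP.
apply/forallP => i2; apply/implyP => _; rewrite !(tnth_nth pone) dE ij.
by case: i1 i2 => [[|[|?]] ?] [[|[|?]] ?].
Qed.

Lemma In_cat (T : Type) (x : T) (s1 s2 : seq T) :
  List.In x (s1 ++ s2) -> List.In x s1 \/ List.In x s2.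
Proof.
elim: s1 => [|y s1 IH] /=; first by right.
by case=> [->|/IH[]]; auto.
Qed.

(** * Functions realized by quantified conjunctions of atoms *)

Section Realization.

Context (K : comNzSemiRingType) (S : schema) (V : vocabulary).
Context (E : encoding S V).

Definition env : Type := nat -> size_sym S * nat.

Definition env_type (v : env) : nat -> size_sym S := fun x => (v x).1.

Definition env_upd (v : env) (y : nat) (p : size_sym S * nat) : env :=
  fun x => if x == y then p else v x.

(** The second component of an environment maps each variable to the center of
    its star: two distinct variables may share a relational atom only if one of
    them is the center of the other one. *)
Definition atom_ok (v : env) (a : atom V) : Prop :=
  atom_typed E (Some \o env_type v) a /\
  (is_rel_atom a ->
     (forall x, x \in avars a -> (v x).2 \in avars a) /\
     (forall x y, x \in avars a -> y \in avars a -> x != y ->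
        (v x).2 = y \/ (v y).2 = x)).

Lemma atom_ok_ext v v' a : {in avars a, v =1 v'} -> atom_ok v a -> atom_ok v' a.
Proof.
move=> vv [at_ ast]; split.
  case: a vv at_ {ast} => [R t|x c] vv /=; last first.
    by rewrite /env_type vv ?mem_head.
  move: vv; rewrite /avars /=; case: (tval t) => [|x [|y [|]]] // vv.
    by rewrite /env_type vv ?mem_head.
  by rewrite /env_type !vv ?inE ?eqxx ?orbT.
move=> /ast [s1 s2]; split=> [x xa|x y xa ya]; first by rewrite -vv// s1.
by rewrite -!vv//; exact: s2.
Qed.

(** The freshness bound [N] replaces the renaming of variables: a product is
    realized by passing the extended environment [v'] and the bound [N'] of the
    first factor on to the second one. *)
Definition realizable (xs : seq nat) (v : env) (N : nat)
    (f : instance K S -> valuation -> K) : Prop :=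
  exists v' N' ys a s,
  [/\ [/\ (N <= N')%N, forall x, (x < N)%N -> v' x = v x, uniq ys
        & forall y, y \in ys -> (N <= y < N')%N],
      avars_of (a :: s) =i xs ++ ys,
      forall b, List.In b (a :: s) -> atom_ok v' b
    & forall I nu, f I nu = tsum I (env_type v') ys
        (fun nu => \prod_(b <- a :: s) atom_sem (Rel E I) b nu) nu].

Lemma realizable_ext xs ys v N f g : xs =i ys -> f =2 g ->
  realizable xs v N f -> realizable ys v N g.
Proof.
move=> xy fg [v' [N' [zs [a [s [H1 H2 H3 H4]]]]]]; exists v', N', zs, a, s.
split=> // [z|I nu]; last by rewrite -fg.
by rewrite H2 !mem_cat xy.
Qed.

Lemma realizable_atom xs v N a : avars a =i xs -> atom_ok v a ->
  realizable xs v N (fun I nu => atom_sem (Rel E I) a nu).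
Proof.
move=> axs aok; exists v, N, [::], a, [::]; split=> //.
- by move=> z; rewrite /avars_of /= !cats0.
- by move=> b [<-|].
- by move=> I nu; rewrite /= big_seq1.
Qed.

(** The quantified variables of the factors lie in [[N, N1)] and [[N1, N2)], and the free ones below
    [N]. No variable is captured, so [tsum_mul] merges the two blocks. *)
Lemma realizable_mul xs1 xs2 v N f g :
  (forall x, x \in xs1 ++ xs2 -> (x < N)%N) ->
  realizable xs1 v N f ->
  (forall v' N', (N <= N')%N -> (forall x, (x < N)%N -> v' x = v x) ->
     realizable xs2 v' N' g) ->
  realizable (xs1 ++ xs2) v N (fun I nu => f I nu * g I nu).
Proof.
move=> xsN [v1 [N1 [ys1 [a1 [s1 [[NN1 vv1 u1 ys1N] av1 ok1 sem1]]]]]].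
move=> /(_ _ _ NN1 vv1).
move=> [v2 [N2 [ys2 [a2 [s2 [[NN2 vv2 u2 ys2N] av2 ok2 sem2]]]]]].
have xsN1 x : x \in xs1 -> (x < N)%N by move=> xx; rewrite xsN// mem_cat xx.
have xsN2 x : x \in xs2 -> (x < N)%N.
  by move=> xx; rewrite xsN// mem_cat xx orbT.
have dis12 y : y \in ys1 -> y \notin xs2 ++ ys2.
  move=> /ys1N /andP[Ny yN1]; rewrite mem_cat negb_or; apply/andP; split.
    by apply/negP => /xsN2; rewrite ltnNge Ny.
  by apply/negP => /ys2N /andP[]; rewrite leqNgt yN1.
have dis21 y : y \in ys2 -> y \notin xs1 ++ ys1.
  move=> yys; rewrite mem_cat negb_or; apply/andP; split; apply/negP.
    move=> /xsN1; have /andP[N1y _] := ys2N _ yys.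
    by rewrite ltnNge (leq_trans NN1).
  by move=> /dis12; rewrite mem_cat yys orbT.
exists v2, N2, (ys1 ++ ys2), a1, (s1 ++ a2 :: s2); split.
- split.
  + exact: leq_trans NN2.
  + by move=> x xN; rewrite vv2 ?vv1// (leq_trans xN).
  + rewrite cat_uniq u1 u2 andbT /=; apply/hasPn => y /dis21.
    by rewrite mem_cat negb_or => /andP[].
  + move=> y; rewrite mem_cat => /orP[/ys1N/andP[Ny yN]|/ys2N/andP[Ny yN]].
      by rewrite Ny (leq_trans yN).
    by rewrite yN (leq_trans NN1).
- move=> z; rewrite -cat_cons avars_of_cat mem_cat av1 av2 !mem_cat.
  by rewrite orbACA.
- move=> b /(@In_cat _ b (a1 :: s1) (a2 :: s2)) [bs|]; last exact: ok2.
  apply: atom_ok_ext (ok1 _ bs) => x xb; rewrite vv2//.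
  have : x \in avars_of (a1 :: s1) by apply/avars_ofP; exists b.
  rewrite av1 mem_cat => /orP[/xsN1 xN|/ys1N/andP[]//].
  exact: leq_trans NN1.
- move=> I nu; rewrite sem1 sem2.
  rewrite (@eq_tsum_typing _ _ _ (env_type v1) (env_type v2)); last first.
    by move=> y /ys1N/andP[_ yN1]; rewrite /env_type vv2.
  rewrite -(@tsum_mul _ _ _ _ _ _ (avars_of (a1 :: s1)) (avars_of (a2 :: s2))).
  + by apply: eq_tsum => mu; rewrite -cat_cons big_cat.
  + exact: prod_atom_sem_depends_on.
  + exact: prod_atom_sem_depends_on.
  + by apply/hasPn => y /dis12; rewrite -av2.
  + by apply/hasPn => y /dis21; rewrite -av1.
Qed.

Lemma realizable_sum xs v N a c f : (forall x, x \in xs -> (x < N)%N) ->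
  realizable (N :: xs) (env_upd v N (a, c)) N.+1 f ->
  realizable xs v N
    (fun I nu => \sum_(d < sdim I a) f I (upd nu N (psucc d))).
Proof.
move=> xsN [v1 [N1 [ys [b [s [[NN1 vv1 u1 ysN] av1 ok1 sem1]]]]]].
exists v1, N1, (N :: ys), b, s; split=> //.
- split.
  + exact: ltnW.
  + move=> x xN; rewrite vv1 /env_upd; last exact: ltnW.
    by rewrite ltn_eqF.
  + by rewrite /= u1 andbT; apply/negP => /ysN; rewrite ltnn.
  + move=> y; rewrite inE => /orP[/eqP->|/ysN/andP[/ltnW-> ->]//].
    by rewrite leqnn.
- by move=> z; rewrite av1 !(mem_cat, inE) orbCA -orbA.
- move=> I nu /=; have -> : env_type v1 N = a.
    by rewrite /env_type vv1 /env_upd ?eqxx.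
  by apply: eq_bigr => d _; rewrite sem1.
Qed.

Definition scal (f : instance K S -> K) : Prop :=
  forall v N, realizable [::] v N (fun I _ => f I).

(** The variable must be its own center, since several unary factors and the arms of a star may meet
    there. *)
Definition una (a : size_sym S) (f : instance K S -> posnat -> K) : Prop :=
  forall v N x, (x < N)%N -> v x = (a, x) ->
  realizable [:: x] v N (fun I nu => f I (nu x)).

(** Both variables share one center, and either of them may be chosen. The choice is left open so
    that it can later fall on the variable that carries unary factors. *)
Definition pair (a b : size_sym S) (f : instance K S -> posnat -> posnat -> K) :
    Prop :=
  forall v N x y, (x < N)%N -> (y < N)%N -> x != y ->
  (v x = (a, x) /\ v y = (b, x)) \/ (v x = (a, y) /\ v y = (b, y)) ->
  realizable [:: x; y] v N (fun I nu => f I (nu x) (nu y)).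

Lemma una_ext a f g : f =2 g -> una a f -> una a g.
Proof.
move=> fg fu v N x xN vx; apply: realizable_ext (fu v N x xN vx) => // I nu.
Qed.

Lemma pair_ext a b f g : (forall I i j, f I i j = g I i j) ->
  pair a b f -> pair a b g.
Proof.
move=> fg fp v N x y xN yN xy vxy.
by apply: realizable_ext (fp v N x y xN yN xy vxy) => // I nu.
Qed.

Lemma scal_ext f g : f =1 g -> scal f -> scal g.
Proof. by move=> fg fs v N; apply: realizable_ext (fs v N) => // I nu. Qed.

Lemma una_mul a f g : una a f -> una a g -> una a (fun I i => f I i * g I i).
Proof.
move=> fu gu v N x xN vx.
apply: (@realizable_ext ([:: x] ++ [:: x]) _ _ _
  (fun I nu => f I (nu x) * g I (nu x))) => //.
  by move=> z; rewrite !inE orbb.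
apply: (@realizable_mul _ _ _ _ (fun I nu => f I (nu x)) (fun I nu => g I (nu x))).
- by move=> z; rewrite !inE orbb => /eqP->.
- exact: fu.
- move=> v' N' NN' vv'; apply: gu; first exact: leq_trans NN'.
  by rewrite vv'.
Qed.

Lemma una_scal a f g : scal f -> una a g -> una a (fun I i => f I * g I i).
Proof.
move=> fs gu v N x xN vx.
apply: (@realizable_mul [::] [:: x] _ _ (fun I _ => f I) (fun I nu => g I (nu x))).
- by move=> z; rewrite !inE => /eqP->.
- exact: fs.
- move=> v' N' NN' vv'; apply: gu; first exact: leq_trans NN'.
  by rewrite vv'.
Qed.

Lemma pair_mul a b f g : pair a b f -> pair a b g ->
  pair a b (fun I i j => f I i j * g I i j).
Proof.
move=> fp gp v N x y xN yN xy vxy.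
apply: (@realizable_ext ([:: x; y] ++ [:: x; y]) _ _ _
  (fun I nu => f I (nu x) (nu y) * g I (nu x) (nu y))) => //.
  by move=> z; rewrite mem_cat orbb.
apply: (@realizable_mul _ _ _ _ (fun I nu => f I (nu x) (nu y))
  (fun I nu => g I (nu x) (nu y))).
- by move=> z; rewrite mem_cat orbb !inE => /orP[]/eqP->.
- exact: fp.
- move=> v' N' NN' vv'; apply: gp => //; try exact: leq_trans NN'.
  by rewrite !vv'.
Qed.

Lemma pair_scal a b f g : scal f -> pair a b g ->
  pair a b (fun I i j => f I * g I i j).
Proof.
move=> fs gp v N x y xN yN xy vxy.
apply: (@realizable_mul [::] [:: x; y] _ _ (fun I _ => f I)
  (fun I nu => g I (nu x) (nu y))).
- by move=> z; rewrite !inE => /orP[]/eqP->.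
- exact: fs.
- move=> v' N' NN' vv'; apply: gp => //; try exact: leq_trans NN'.
  by rewrite !vv'.
Qed.

Lemma pair_tr a b f : pair a b f -> pair b a (fun I i j => f I j i).
Proof.
move=> fp v N x y xN yN xy vxy.
apply: (realizable_ext (xs := [:: y; x]) _ (fun _ _ => erefl)).
  by move=> z; rewrite !inE orbC.
by apply: fp => //; [rewrite eq_sym|case: vxy => -[]; auto].
Qed.

Lemma una_sum a f : una a f ->
  scal (fun I => \sum_(d < sdim I a) f I (psucc d)).
Proof.
move=> fu v N.
have := @realizable_sum [::] v N a N (fun I nu => f I (nu N)).
move=> H; apply: realizable_ext (H _ _) => //.
  by move=> I nu; apply: eq_bigr => d _; rewrite upd_eq.
by apply: fu => //; rewrite /env_upd eqxx.
Qed.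

Lemma pair_sum a b f : pair a b f ->
  una a (fun I i => \sum_(d < sdim I b) f I i (psucc d)).
Proof.
move=> fp v N x xN vx.
have := @realizable_sum [:: x] v N b x (fun I nu => f I (nu x) (nu N)).
move=> H; apply: realizable_ext (H _ _) => //.
- move=> I nu; apply: eq_bigr => d _; rewrite upd_eq upd_neq//.
  by rewrite ltn_eqF.
- by move=> z; rewrite inE => /eqP->.
- apply: (realizable_ext (xs := [:: x; N]) _ (fun _ _ => erefl)).
    by move=> z; rewrite !inE orbC.
  apply: fp => //; first exact: ltnW.
    by rewrite ltn_eqF.
  by left; rewrite /env_upd eqxx ltn_eqF.
Qed.

(** An all-ones vector is expressed by a comparison atom. As this atom is not relational, it puts no
    condition on centers. *)
Lemma realizable_le a v N x : env_type v x = a ->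
  realizable [:: x] v N (fun I nu => (val (nu x) <= sdim I a)%N%:R).
Proof.
move=> vx; apply: realizable_ext (realizable_atom (xs := [:: x])
  (a := ALe x (rel_size E a)) N _ _) => //.
  by move=> I nu; rewrite atom_sem_Le rel_sizeK.
by split=> //=; rewrite rel_sizeK vx.
Qed.

Lemma una_le a : una a (fun I i => (val i <= sdim I a)%N%:R).
Proof. by move=> v N x _ vx; apply: realizable_le; rewrite /env_type vx. Qed.

(** A sum over a dimension equal to one has a single term, so a position of type [sone] is filled by
    a fresh quantified variable rather than by a head variable. *)
Lemma una_sone_scal f : una sone f -> scal (fun I => f I pone).
Proof.
move=> /una_sum; apply: scal_ext => I; rewrite sdim_sone big_ord1.
by rewrite (_ : psucc _ = pone).
Qed.

Lemma scal_una a f : scal f ->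
  una a (fun I i => f I * (val i <= sdim I a)%N%:R).
Proof. by move=> fs; apply: una_scal fs _; apply: una_le. Qed.

Lemma ent_sone_r (I : instance K S) a (e : expr a sone) i j :
  ent I e i j = ent I e i pone * (val j <= 1)%N%:R.
Proof.
case: leqP => [/posnat_le1->|j1]; first by rewrite mulr1.
by rewrite mulr0 ent_outr// sdim_sone.
Qed.

Lemma ent_sone_l (I : instance K S) b (e : expr sone b) i j :
  ent I e i j = ent I e pone j * (val i <= 1)%N%:R.
Proof. by rewrite -ent_tr ent_sone_r ent_tr. Qed.

(** * Matrix symbols as relational atoms *)

Section Symbol.

Context (R : rel_sym V).

Lemma sym_pair : arity R = 2%N ->
  pair (mrow (mat_rel E R)) (mcol (mat_rel E R))
    (fun I => ent I (ESym (mat_rel E R))).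
Proof.
move=> R2 v N x y xN yN xy vxy.
have sz : size [:: x; y] == arity R by rewrite R2.
apply: realizable_ext (realizable_atom (xs := [:: x; y])
  (a := ARel (Tuple sz)) N _ _) => //.
split=> /=; first by case: vxy => -[vx vy]; rewrite /env_type /= vx vy.
move=> _; rewrite /avars /=; split.
  by move=> z; rewrite !inE => /orP[]/eqP->; case: vxy => -[vx vy];
    rewrite ?vx ?vy eqxx ?orbT.
move=> z z'; rewrite !inE => /orP[]/eqP-> /orP[]/eqP->; rewrite ?eqxx // => _;
  case: vxy => -[vx vy] /=; rewrite vx vy; by [left|right].
Qed.

Lemma sym_diag : arity R = 2%N -> mrow (mat_rel E R) = mcol (mat_rel E R) ->
  una (mrow (mat_rel E R)) (fun I i => ent I (ESym (mat_rel E R)) i i).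
Proof.
move=> R2 rc v N x xN vx.
have sz : size [:: x; x] == arity R by rewrite R2.
apply: realizable_ext (realizable_atom (xs := [:: x])
  (a := ARel (Tuple sz)) N _ _) => //.
  by move=> z; rewrite /avars /= !inE orbb.
split=> /=; first by rewrite /env_type /= vx; split=> //; rewrite rc.
move=> _; rewrite /avars /=; split.
  by move=> z; rewrite !inE orbb => /eqP->; rewrite vx eqxx.
by move=> z z'; rewrite !inE !orbb => /eqP-> /eqP->; rewrite eqxx.
Qed.

Lemma sym_una1 : arity R = 1%N ->
  (mcol (mat_rel E R) = sone -> una (mrow (mat_rel E R))
     (fun I i => ent I (ESym (mat_rel E R)) i pone)) /\
  (mrow (mat_rel E R) = sone -> una (mcol (mat_rel E R))
     (fun I i => ent I (ESym (mat_rel E R)) pone i)).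
Proof.
move=> R1.
have base a : (mcol (mat_rel E R) = sone /\ a = mrow (mat_rel E R)) \/
    (mrow (mat_rel E R) = sone /\ a = mcol (mat_rel E R)) ->
  una a (fun I i => if mcol (mat_rel E R) == sone
    then ent I (ESym (mat_rel E R)) i pone
    else ent I (ESym (mat_rel E R)) pone i).
  move=> aE v N x xN vx.
  have sz : size [:: x] == arity R by rewrite R1.
  apply: realizable_ext (realizable_atom (xs := [:: x])
    (a := ARel (Tuple sz)) N _ _) => //.
    by move=> I nu; rewrite (@atom_sem_Rel1 _ _ _ _ _ _ _ x).
  split=> /=.
    by rewrite /env_type /= vx; case: aE => -[-> ->]; [left|right].
  move=> _; rewrite /avars /=; split.
    by move=> z; rewrite !inE => /eqP->; rewrite vx eqxx.
  by move=> z z'; rewrite !inE => /eqP-> /eqP->; rewrite eqxx.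
split=> s1.
  apply: una_ext (base _ _); last by left.
  by move=> I i; move/eqP: s1 => ->.
apply: una_ext (base _ _); last by right.
(* For type [(sone, sone)] the atom reads a column although a row is wanted: the two agree at [pone]
   and both vanish elsewhere. *)
move=> I i; case: (mcol _ =P sone) => // c1.
case: (leqP (val i) 1) => [/posnat_le1->//|i1].
by rewrite ent_outl ?ent_outr// ?s1 ?c1 sdim_sone.
Qed.

Lemma sym_scal : arity R = 0%N ->
  scal (fun I => ent I (ESym (mat_rel E R)) pone pone).
Proof.
move=> R0 v N.
have sz : size ([::] : seq nat) == arity R by rewrite R0.
have := enc_arity E R; rewrite R0 => rc.
apply: realizable_ext (realizable_atom (xs := [::])
  (a := ARel (Tuple sz)) N _ _) => //.
Qed.

End Symbol.

(** [a <> sone] and [b <> sone] leave only Hadamard products of symbols and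
    identities, hence no unary factor that would break the hierarchy. *)
Definition simple_form a b (g : instance K S -> posnat -> posnat -> K) : Prop :=
  [/\ b = sone -> una a (fun I i => g I i pone),
      a = sone -> una b (fun I j => g I pone j)
    & a <> sone -> b <> sone ->
      (a = b -> una a (fun I i => g I i i)) /\
      (pair a b g \/ (a = b /\ forall I i j, i <> j -> g I i j = 0))].

(** By arity: a nullary symbol becomes a vector by means of a comparison atom, a unary one has a
    dimension of type [sone], and a binary one used as a vector has its position of type [sone]
    summed out. *)
Lemma sym_simple_form (R : rel_sym V) :
  simple_form (mrow (mat_rel E R)) (mcol (mat_rel E R))
    (fun I => ent I (ESym (mat_rel E R))).
Proof.
have := enc_arity E R; case Rk: (arity R) => [|[|[|//]]] /=.
- case=> r1 c1; split=> //.
    move=> _; apply: una_ext (@scal_una (mrow (mat_rel E R)) _ (sym_scal Rk)) => I i.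
    move: (ESym _); rewrite r1 c1 => e /=.
    by rewrite [RHS]ent_sone_l sdim_sone.
  move=> _; apply: una_ext (@scal_una (mcol (mat_rel E R)) _ (sym_scal Rk)) => I i.
  move: (ESym _); rewrite r1 c1 => e /=.
  by rewrite [RHS]ent_sone_r sdim_sone.
- by have [c r] := sym_una1 Rk => -[] rc; split=> // na nb; case: (nb).
- move=> _; split.
  + move=> c1; apply: una_ext (pair_sum (sym_pair Rk)) => I i.
    by move: (ESym _); rewrite c1 sdim_sone => e; rewrite big_ord1.
  + move=> r1; apply: una_ext (pair_sum (pair_tr (sym_pair Rk))) => I i /=.
    by move: (ESym _); rewrite r1 sdim_sone => e; rewrite big_ord1.
  + by move=> _ _; split; [exact: sym_diag|left; exact: sym_pair].
Qed.

(** Induction on the expression. One diagonal Hadamard factor, such as an identity, confines the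
    whole product to the diagonal, where it is a unary function; this is why pairs carry their
    diagonal through the induction as well. *)
Lemma simple_form_simple a b (e : expr a b) : simple_matlang e ->
  simple_form a b (fun I => ent I e).
Proof.
elim=> {a b e}.
- move=> A; rewrite -(rel_matK E A); exact: sym_simple_form.
- move=> a; split=> //.
    move=> _; apply: una_ext (@una_le a) => I i.
    by rewrite ent_ones andbT.
  move=> a1; apply: una_ext (@una_le sone) => I i.
  by rewrite ent_ones sdim_sone sdim_gt0.
- move=> a; split.
  + move=> ->; apply: una_ext (@una_le sone) => I i.
    rewrite ent_id sdim_sone; case: leqP => //= /posnat_le1->.
    by rewrite eqxx.
  + move=> ->; apply: una_ext (@una_le sone) => I i.
    rewrite ent_id sdim_sone /=; congr _%:R.
    by case: eqP => [<-//|]; case: leqP => // /posnat_le1->.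
  + move=> _ _; split=> [_|].
      by apply: una_ext (@una_le a) => I i; rewrite ent_id eqxx andbT.
    by right; split=> // I i j /eqP ij; rewrite ent_id (negPf ij) andbF.
- move=> a b e _ [ec er ep]; split.
  + by move=> /er; apply: una_ext => I i; rewrite ent_tr.
  + by move=> /ec; apply: una_ext => I i; rewrite ent_tr.
  + move=> b1 a1; have [ed ep'] := ep a1 b1; split.
      move=> ba; apply: (@una_ext _ (fun I i => ent I e i i)) => [I i|].
        by rewrite ent_tr.
      by rewrite {1}ba; exact: ed.
    case: ep' => [/pair_tr ept|[ab e0]].
      by left; apply: pair_ext ept => I i j; rewrite ent_tr.
    by right; split=> // I i j ij; rewrite ent_tr e0//; exact: nesym.
- move=> a b e1 e2 _ [s1 _ _] _ [ec er ep].
  have {}s1 := una_sone_scal (s1 erefl); split.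
  + move=> /ec /(una_scal s1); apply: una_ext => I i.
    by rewrite ent_scale.
  + move=> /er /(una_scal s1); apply: una_ext => I i.
    by rewrite ent_scale.
  + move=> a1 b1; have [ed ep'] := ep a1 b1; split.
      move=> /ed /(una_scal s1); apply: una_ext => I i.
      by rewrite ent_scale.
    case: ep' => [/(pair_scal s1) ept|[ab e0]].
      by left; apply: pair_ext ept => I i j; rewrite ent_scale.
    by right; split=> // I i j ij; rewrite ent_scale e0// mulr0.
- move=> a b e1 e2 _ [ec1 er1 ep1] _ [ec er ep]; split.
  + move=> b1; apply: una_ext (una_mul (ec1 b1) (ec b1)) => I i.
    by rewrite ent_had.
  + move=> a1; apply: una_ext (una_mul (er1 a1) (er a1)) => I i.
    by rewrite ent_had.
  + move=> a1 b1; have [ed1 ep1'] := ep1 a1 b1; have [ed ep'] := ep a1 b1.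
    split.
      move=> ab; apply: una_ext (una_mul (ed1 ab) (ed ab)) => I i.
      by rewrite ent_had.
    case: ep1' => [ept1|[ab e0]]; last first.
      by right; split=> // I i j ij; rewrite ent_had e0// mul0r.
    case: ep' => [ept|[ab e0]]; last first.
      by right; split=> // I i j ij; rewrite ent_had e0// mulr0.
    by left; apply: pair_ext (pair_mul ept1 ept) => I i j; rewrite ent_had.
- move=> a b e _ [ec er ep].
  have una1 : una a (fun I i => ent I (EMul e (EOnes b)) i pone).
    apply: (@una_ext _ (fun I i => \sum_(d < sdim I b) ent I e i (psucc d))).
      by move=> I i; rewrite ent_mul_ones mulr1.
    have [b1|nb1] := eqVneq b sone.
      apply: una_ext (ec b1) => I i.
      by move: (e); rewrite b1 sdim_sone => e'; rewrite big_ord1.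
    have [a1|na1] := eqVneq a sone.
      apply: una_ext (@scal_una a _ (una_sum (er a1))) => I i.
      rewrite big_distrl /=; apply: eq_bigr => d _.
      by move: (e); rewrite a1 => e'; rewrite [RHS]ent_sone_l sdim_sone.
    have [ed []] := ep (elimN eqP na1) (elimN eqP nb1).
      by move=> /pair_sum.
    (* A row of a matrix supported on the diagonal sums to its diagonal entry. *)
    case=> ab e0; apply: una_ext (ed ab) => I i.
    case: (posnatP (sdim I b) i) => [i0 _|oi].
      rewrite (bigD1 i0)//= big1 ?addr0// => d di0.
      by rewrite e0// => -[/ord_inj] /eqP; rewrite eq_sym (negPf di0).
    by rewrite ent_outr// big1// => d _; rewrite ent_outl// ab.
  split=> // a1; move: una1; rewrite {1}a1 => {}una1.
  apply: una_ext (@scal_una sone _ (una_sone_scal una1)) => I i.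
  by rewrite [RHS]ent_sone_r sdim_sone.
Qed.

(** The variables [0] and [1] stand for the row and the column. *)
Definition head_env (a b : size_sym S) (c0 c1 : nat) : env :=
  fun x => if x == 0%N then (a, c0) else (b, c1).

(** Compared with [simple_form], the centers of the two head variables are now fixed by the
    realization, because unary factors in the product may impose them. The diagonal alternative
    corresponds to a head with a repeated variable. *)
Definition query_form a b (g : instance K S -> posnat -> posnat -> K) : Prop :=
  [/\ b = sone -> una a (fun I i => g I i pone),
      a = sone -> una b (fun I j => g I pone j)
    & a <> sone -> b <> sone ->
      [/\ a = b, una a (fun I i => g I i i) & forall I i j, i <> j -> g I i j = 0]
      \/ exists c0 c1, [/\ c0 \in [:: 0; 1]%N, c1 \in [:: 0; 1]%N
         & realizable [:: 0; 1]%N (head_env a b c0 c1) 2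
             (fun I nu => g I (nu 0%N) (nu 1%N))]].

Lemma simple_query_form a b g : simple_form a b g -> query_form a b g.
Proof.
move=> [gc gr gp]; split=> // na nb; have [gd [gp'|[ab g0]]] := gp na nb.
  by right; exists 0%N, 0%N; split=> //; apply: gp' => //; left.
by left; split=> //; exact: gd.
Qed.

Lemma query_form_ext a b f g : (forall I i j, f I i j = g I i j) ->
  query_form a b f -> query_form a b g.
Proof.
move=> fg; rewrite (_ : f = g)//.
by apply: funext => I; apply: funext => i; apply: funext.
Qed.

(** The vector factor requires the row variable [0] to be its own center, so [0] also serves as
    center of the column variable. The left version uses [1] instead; with two vectors and no binary
    factor, each variable is its own center. *)
Lemma query_form_right a b g (h : expr a sone) :
  simple_form a b g -> simple_matlang h ->
  query_form a b (fun I i j => g I i j * ent I h i pone).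
Proof.
move=> [gc gr gp] /simple_form_simple[hc hr _]; split.
- by move=> b1; apply: una_mul (gc b1) (hc erefl).
- move=> a1; have /una_sone_scal hs : una sone (fun I i => ent I h i pone).
    by rewrite -{1}a1; exact: hc.
  by apply: una_ext (una_scal hs (gr a1)) => I i; rewrite mulrC.
- move=> na nb; have [gd [gp'|[ab g0]]] := gp na nb; last first.
    left; split=> // [|I i j ij]; last by rewrite g0// mul0r.
    by apply: una_mul (gd ab) (hc erefl).
  right; exists 0%N, 0%N; split=> //.
  apply: (@realizable_ext ([:: 0; 1] ++ [:: 0])%N _ _ _
    (fun I nu => g I (nu 0%N) (nu 1%N) * ent I h (nu 0%N) pone)) => //.
    by move=> z; rewrite !inE; case: (z == 0%N); rewrite ?orbT ?orbF.
  apply: (@realizable_mul _ _ _ _ (fun I nu => g I (nu 0%N) (nu 1%N))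
    (fun I nu => ent I h (nu 0%N) pone)).
  + by case=> [|[|[]]].
  + by apply: gp' => //; left.
  + move=> v' N' NN' vv'; apply: hc => //; first exact: leq_trans NN'.
    by rewrite vv'.
Qed.

Lemma query_form_left a b g (h : expr sone b) :
  simple_form a b g -> simple_matlang h ->
  query_form a b (fun I i j => ent I h pone j * g I i j).
Proof.
move=> [gc gr gp] /simple_form_simple[hc hr _]; split.
- move=> b1; have /una_sone_scal hs : una sone (fun I i => ent I h pone i).
    by rewrite -{1}b1; exact: hr.
  by apply: una_scal hs (gc b1).
- by move=> a1; apply: una_mul (hr erefl) (gr a1).
- move=> na nb; have [gd [gp'|[ab g0]]] := gp na nb; last first.
    left; split=> // [|I i j ij]; last by rewrite g0// mulr0.
    by apply: una_mul (gd ab); rewrite ab; exact: hr.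
  right; exists 1%N, 1%N; split=> //.
  apply: (@realizable_ext ([:: 1] ++ [:: 0; 1])%N _ _ _
    (fun I nu => ent I h pone (nu 1%N) * g I (nu 0%N) (nu 1%N))) => //.
    by move=> z; rewrite !inE; case: (z == 1%N); rewrite ?orbT ?orbF.
  apply: (@realizable_mul _ _ _ _ (fun I nu => ent I h pone (nu 1%N))
    (fun I nu => g I (nu 0%N) (nu 1%N))).
  + by case=> [|[|[]]].
  + exact: hr.
  + move=> v' N' NN' vv'; apply: gp' => //; try exact: leq_trans NN'.
    by right; rewrite !vv'.
Qed.

Lemma query_form_both a b (g : expr sone b) (h : expr a sone) :
  simple_matlang g -> simple_matlang h ->
  query_form a b (fun I i j => ent I g pone j * ent I h i pone).
Proof.
move=> /simple_form_simple[gc gr _] /simple_form_simple[hc hr _]; split.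
- move=> b1; have /una_sone_scal gs : una sone (fun I i => ent I g pone i).
    by rewrite -{1}b1; exact: gr.
  exact: una_scal gs (hc erefl).
- move=> a1; have /una_sone_scal hs : una sone (fun I i => ent I h i pone).
    by rewrite -{1}a1; exact: hc.
  by apply: una_ext (una_scal hs (gr erefl)) => I i; rewrite mulrC.
- move=> na nb; right; exists 0%N, 1%N; split=> //.
  apply: (@realizable_ext ([:: 1] ++ [:: 0])%N _ _ _
    (fun I nu => ent I g pone (nu 1%N) * ent I h (nu 0%N) pone)) => //.
    by move=> z; rewrite !inE orbC.
  apply: (@realizable_mul _ _ _ _ (fun I nu => ent I g pone (nu 1%N))
    (fun I nu => ent I h (nu 0%N) pone)).
  + by case=> [|[|[]]].
  + exact: gr.
  + move=> v' N' NN' vv'; apply: hc => //; first exact: leq_trans NN'.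
    by rewrite vv'.
Qed.

Lemma qh_query_form a b (e : expr a b) : qh_matlang e ->
  query_form a b (fun I => ent I e).
Proof.
case=> {a b e} a b.
- by move=> e /simple_form_simple /simple_query_form.
- move=> e1 e2 /simple_form_simple s1 s2.
  apply: query_form_ext (query_form_right s1 s2) => I i j.
  rewrite ent_had ent_mul_ones_tr.
  (* The range condition from the all-ones row is absorbed by [e1], which vanishes outside its
     dimensions. *)
  by case: leqP => [_|oj]; rewrite ?mulr1// ent_outr// !mul0r.
- move=> e1 e2 s1 /simple_form_simple s2.
  apply: query_form_ext (query_form_left s2 s1) => I i j.
  rewrite ent_had ent_ones_mul.
  by case: leqP => [_|oi]; rewrite ?mul1r// (ent_outl e2)// !mulr0.
- move=> e1 e2 s1 s2.
  apply: query_form_ext (query_form_both s1 s2) => I i j.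
  rewrite ent_had ent_ones_mul ent_mul_ones_tr.
  case: leqP => [_|oi]; last by rewrite (ent_outl e2) ?mul0r ?mulr0.
  by case: leqP => [_|oj]; rewrite ?mul1r ?mulr1// (ent_outr e1) ?mul0r.
Qed.

(** Quantified variables start at [N], above all head variables, so the free variables are exactly
    the head. The recorded centers are stable on the head and [star_q_hierarchical] applies. *)
Lemma realizable_cq k (h : k.-tuple nat) v N f :
  (forall x, x \in h -> (x < N)%N) -> (forall x, x \in h -> (v x).2 \in h) ->
  realizable h v N f ->
  exists Q : cq V k, [/\ cq_head Q = h, q_hierarchical Q,
    exists2 tau, typed E (cq_formula Q) tau &
      forall x, x \in h -> tau x = Some (v x).1
  & forall I t, cq_output Q (Rel E I) t =
      if respects h t then f I (head_valuation h t) else 0].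
Proof.
move=> hN hc [v1 [N1 [ys [a [s [[NN1 vv1 u1 ysN] av ok sem1]]]]]].
have ys_h x : x \in h -> x \notin ys.
  by move=> /hN xN; apply/negP => /ysN /andP[]; rewrite leqNgt xN.
have ysub : {subset ys <= fvars (fconj a s)}.
  by move=> y yys; rewrite fvars_fconj av mem_cat yys orbT.
have hfree : h =i fvars (cq_formula_of ys a s).
  move=> x; rewrite mem_fvars_ex fvars_fconj av mem_cat.
  case xh: (x \in h); first by rewrite ys_h.
  by rewrite orFb andNb.
exists (CQ u1 ysub hfree); split=> //.
- apply: (@star_q_hierarchical _ _ _ (fun x => (v1 x).2)) => /=.
    by move=> b /ok [_ bst]; exact: bst.
  by move=> x xh; rewrite vv1 ?hN// hc.
- have ty := fconj_typed (fun b bs => (ok b bs).1).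
  exists (fun x => if x \in ys then None else if x \in fvars (fconj a s)
    then Some (env_type v1 x) else None); first exact: foldr_ex_typed ty.
  move=> x xh; rewrite (negPf (ys_h _ xh)) fvars_fconj av mem_cat.
  have -> : x \in tval h by [].
  by rewrite /env_type vv1// hN.
- move=> I t; rewrite /cq_output /=; case: ifP => // _.
  rewrite sem1 /cq_formula /= /cq_formula_of.
  rewrite (@sem_exists _ _ _ I (env_type v1))//.
    by apply: eq_tsum => nu; exact: sem_fconj.
  move=> nu; rewrite sem_fconj => /prod_atom_sem_neq0 nz y yys.
  have : y \in avars_of (a :: s) by rewrite av mem_cat yys orbT.
  move=> /avars_ofP[b bs yb].
  exact: atom_typed_bound (ok b bs).1 (nz b bs) _ yb.
Qed.

Lemma encoding_binary a b k (Q : cq V k) : @arity_compat S a b k -> binary Q.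
Proof.
move=> /arity_compat_le2 k2; split=> // R t _.
exact: arity_compat_le2 (enc_arity E R).
Qed.

Lemma qh_matlang_cq a b (e : expr a b) k (abk : arity_compat a b k) :
  qh_matlang e ->
  exists Q : cq V k,
    [/\ binary Q, q_hierarchical Q, entry_simulates K E Q e & well_typed E a b Q].
Proof.
move=> /qh_query_form[ec er ep]; case: k abk => [|[|[|//]]] abk.
- case: (abk) => a1 b1; have [] := @realizable_cq 0 [tuple] (head_env a b 0 0) 0
    (fun I _ => ent I e pone pone) => //.
    have : una sone (fun I i => ent I e i pone) by rewrite -{1}a1; exact: ec.
    by move=> /una_sone_scal; exact.
  move=> Q [hQ qQ [tau tauQ _] oQ]; exists Q; split=> //.
  + exact: encoding_binary abk.
  + move=> I t; rewrite oQ respects_uniq//.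
    by rewrite (tuple0 t).
  + by exists tau => //; rewrite hQ.
- have [b1|nb1] := eqVneq b sone.
    have [] := @realizable_cq 1 [tuple 0%N] (head_env a b 0 0) 1
      (fun I nu => ent I e (nu 0%N) pone).
    + by move=> x; rewrite inE => /eqP->.
    + by move=> x; rewrite inE => /eqP->.
    + exact: ec.
    move=> Q [hQ qQ [tau tauQ tauE] oQ]; exists Q; split=> //.
    + exact: encoding_binary abk.
    + move=> I t; rewrite oQ respects_uniq//.
      by case: t => -[|i [|? ?]] //= sz; move/eqP: (b1) => ->.
    + exists tau => //; rewrite hQ /=; left; split=> //.
      by rewrite tauE ?inE.
  have a1 : a = sone by case: abk => // b1; rewrite b1 eqxx in nb1.
  (* The types are swapped because the only head variable, [0], now runs over the columns. *)
  have [] := @realizable_cq 1 [tuple 0%N] (head_env b a 0 0) 1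
    (fun I nu => ent I e pone (nu 0%N)).
  + by move=> x; rewrite inE => /eqP->.
  + by move=> x; rewrite inE => /eqP->.
  + exact: er.
  move=> Q [hQ qQ [tau tauQ tauE] oQ]; exists Q; split=> //.
  + exact: encoding_binary abk.
  + move=> I t; rewrite oQ respects_uniq//.
    by case: t => -[|i [|? ?]] //= sz; rewrite (negPf nb1).
  + exists tau => //; rewrite hQ /=; right; split=> //.
    by rewrite tauE ?inE.
have : 
  [/\ a = b, una a (fun I i => ent I e i i)
    & forall (I : instance K S) i j, i <> j -> ent I e i j = 0] \/
  exists c0 c1, [/\ c0 \in [:: 0; 1]%N, c1 \in [:: 0; 1]%N
    & realizable [:: 0; 1]%N (head_env a b c0 c1) 2
        (fun I nu => ent I e (nu 0%N) (nu 1%N))].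
  (* A binary head with a dimension of type [sone] keeps a head variable there, but one that occurs
     in a comparison atom only, so it does not affect the hierarchy. *)
  have [b1|nb1] := eqVneq b sone.
    right; exists 0%N, 1%N; split=> //.
    apply: (@realizable_ext ([:: 0] ++ [:: 1])%N _ _ _ (fun I nu =>
      ent I e (nu 0%N) pone * (val (nu 1%N) <= sdim I sone)%N%:R)) => //.
      move=> I nu; rewrite sdim_sone; move: (e); rewrite b1 => e'.
      by rewrite [RHS]ent_sone_r.
    apply: (@realizable_mul _ _ _ _ (fun I nu => ent I e (nu 0%N) pone)
      (fun I nu => (val (nu 1%N) <= sdim I sone)%N%:R)).
    + by case=> [|[|[]]].
    + exact: ec.
    + by move=> v' N' _ vv'; apply: realizable_le; rewrite /env_type vv'.
  have [a1|na1] := eqVneq a sone; last exact: ep (elimN eqP na1) (elimN eqP nb1).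
  right; exists 0%N, 1%N; split=> //.
  apply: (@realizable_ext ([:: 1] ++ [:: 0])%N _ _ _ (fun I nu =>
    ent I e pone (nu 1%N) * (val (nu 0%N) <= sdim I sone)%N%:R)) => //.
    by move=> z; rewrite !inE orbC.
    move=> I nu; rewrite sdim_sone; move: (e); rewrite a1 => e'.
    by rewrite [RHS]ent_sone_l.
  apply: (@realizable_mul _ _ _ _ (fun I nu => ent I e pone (nu 1%N))
    (fun I nu => (val (nu 0%N) <= sdim I sone)%N%:R)).
  + by case=> [|[|[]]].
  + exact: er.
  + by move=> v' N' _ vv'; apply: realizable_le; rewrite /env_type vv'.
case=> [[ab eu e0]|[c0 [c1 [c0h c1h re]]]].
  (* A diagonal matrix is obtained by repeating a head variable: [respects] yields zero off the
     diagonal. *)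
  have [] := @realizable_cq 2 [tuple 0%N; 0%N] (head_env a b 0 0) 1
    (fun I nu => ent I e (nu 0%N) (nu 0%N)).
  + by move=> x; rewrite !inE orbb => /eqP->.
  + by move=> x; rewrite !inE orbb => /eqP->.
  + apply: (realizable_ext (xs := [:: 0%N]) _ (fun _ _ => erefl)).
      by move=> z; rewrite !inE orbb.
    exact: eu.
  move=> Q [hQ qQ [tau tauQ tauE] oQ]; exists Q; split=> //.
  + exact: encoding_binary abk.
  + move=> I t; rewrite oQ.
    case: t => -[|i [|j [|? ?]]] //= sz.
    rewrite (respects_diag (x := 0%N) (i := i) (j := j))//.
    by case: eqP => [<-//|ij]; rewrite e0.
  + by exists tau => //; rewrite hQ /= !tauE ?inE//= ab.
have [] := @realizable_cq 2 [tuple 0%N; 1%N] (head_env a b c0 c1) 2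
  (fun I nu => ent I e (nu 0%N) (nu 1%N)).
+ by move=> x; rewrite !inE => /orP[]/eqP->.
+ by move=> x; rewrite /head_env; case: ifP.
+ exact: re.
move=> Q [hQ qQ [tau tauQ tauE] oQ]; exists Q; split=> //.
+ exact: encoding_binary abk.
+ move=> I t; rewrite oQ respects_uniq//.
  by case: t => -[|i [|j [|? ?]]].
+ by exists tau => //; rewrite hQ /= !tauE ?inE.
Qed.

End Realization.

(** * From queries to expressions *)

(** Atoms and factors are given no [eqType] structure, so membership in their lists is [List.In]. *)
Lemma big_In (R T : Type) (idx : R) (op : Monoid.com_law idx) (s : seq T)
    (P Q : pred T) (F G : T -> R) :
  (forall x, List.In x s -> P x = Q x) ->
  (forall x, List.In x s -> P x -> F x = G x) ->
  \big[op/idx]_(x <- s | P x) F x = \big[op/idx]_(x <- s | Q x) G x.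
Proof.
elim: s => [|x s IH] PQ FG; first by rewrite !big_nil.
rewrite !big_cons IH => [|y ys|y ys]; [|exact: PQ (or_intror ys)
  |exact: FG (or_intror ys)].
rewrite -PQ; last by left.
by case: ifP => // Px; rewrite FG//; left.
Qed.

Lemma In_filter (T : Type) (p : pred T) (s : seq T) x :
  List.In x [seq y <- s | p y] <-> List.In x s /\ p x.
Proof.
elim: s => [|y s IH] /=; first by split=> [|[]].
case: ifP => py /=; split.
- by case=> [<-|/IH[]]; auto.
- by case=> -[<-|xs] px; auto; right; apply/IH.
- by case/IH; auto.
- by case=> -[<-|xs] px; [rewrite px in py|apply/IH].
Qed.

Lemma has_In (T : Type) (p : pred T) (s : seq T) :
  has p s <-> exists2 x, List.In x s & p x.
Proof.
elim: s => [|y s IH] /=; first by split=> // -[].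
split=> [/orP[py|/IH[x xs px]]|[x [->->//|xs px]]].
- by exists y => //; left.
- by exists x => //; right.
- by apply/orP; right; apply/IH; exists x.
Qed.

(** * Products of factors and the elimination of quantified variables *)

Section Factors.

Context (K : comNzSemiRingType) (S : schema) (tau : nat -> size_sym S).

(** A list of factors, read as a product, is the state of the elimination. Summing out an isolated
    or dominated variable yields a scalar or a vector, hence again a factor. *)
Inductive factor :=
| FacS of expr (@sone S) sone
| FacU x of expr (tau x) sone
| FacB x y of expr (tau x) (tau y).

Definition fac_vars (f : factor) : seq nat :=
  match f with FacS _ => [::] | FacU x _ => [:: x] | FacB x y _ => [:: x; y] end.

Definition fac_sem (I : instance K S) (f : factor) (nu : valuation) : K :=
  match f with
  | FacS e => ent I e pone pone
  | FacU x e => ent I e (nu x) pone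
  | FacB x y e => ent I e (nu x) (nu y)
  end.

(** Binary factors have distinct variables; a repeated variable is turned into a unary factor by
    [factor_entry]. *)
Definition fac_wf (f : factor) : Prop :=
  match f with
  | FacS e => simple_matlang e
  | FacU x e => simple_matlang e
  | FacB x y e => x != y /\ simple_matlang e
  end.

Lemma fac_sem_depends_on I f : depends_on (fac_vars f) (fac_sem I f).
Proof.
by case: f => [e|x e|x y e] nu nu' eqnu //=; rewrite !eqnu ?inE ?eqxx ?orbT.
Qed.

Lemma gather_scalar (fs : seq factor) : (forall f, List.In f fs -> fac_wf f) ->
  exists2 c : expr sone sone, simple_matlang c & forall I nu,
    ent I c pone pone = \prod_(f <- fs | fac_vars f == [::]) fac_sem I f nu.
Proof.
elim: fs => [|f fs IH] wf.
  exists (EOnes sone); first exact: SOnes.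
  by move=> I nu; rewrite big_nil ent_ones sdim_sone.
have [c cs ce] := IH (fun f fi => wf f (or_intror fi)).
case: f wf => [e|x e|x y e] wf; first (exists (EHad e c);
  first by apply: SHad => //; exact: wf (FacS e) (or_introl erefl));
  try exists c => //; move=> I nu; rewrite big_cons /= -ce //.
by rewrite ent_had.
Qed.

(** The empty product is the all-ones vector, which equals one only within the dimension; hence the
    bound on [nu x]. *)
Lemma gather_unary x (fs : seq factor) : (forall f, List.In f fs -> fac_wf f) ->
  exists2 u : expr (tau x) sone, simple_matlang u &
    forall I nu, (val (nu x) <= sdim I (tau x))%N ->
    ent I u (nu x) pone = \prod_(f <- fs | fac_vars f == [:: x]) fac_sem I f nu.
Proof.
elim: fs => [|f fs IH] wf.
  exists (EOnes (tau x)); first exact: SOnes.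
  by move=> I nu nux; rewrite big_nil ent_ones nux.
have [u us ue] := IH (fun f fi => wf f (or_intror fi)).
case: f wf => [e|z e|z y e] wf.
- by exists u => // I nu nux; rewrite big_cons /= ue.
- have [zx|zx] := eqVneq z x; last first.
    exists u => // I nu nux; rewrite big_cons /= ue//.
    by rewrite eqseq_cons andbT (negPf zx).
  move: e wf; rewrite zx => e wf; exists (EHad e u).
    by apply: SHad => //; exact: wf (FacU e) (or_introl erefl).
  by move=> I nu nux; rewrite big_cons /= eqxx ent_had ue.
- exists u => // I nu nux; rewrite big_cons /= ue//.
  by rewrite eqseq_cons andbF.
Qed.

(** An empty product would call for an all-ones matrix, for which the simple grammar has no rule, so
    some factor on both variables is required. A factor stored in the order [y], [x] enters
    transposed. *)
Lemma gather_binary x y (fs : seq factor) :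
  (forall f, List.In f fs -> fac_wf f) -> x != y ->
  has (fun f => (x \in fac_vars f) && (y \in fac_vars f)) fs ->
  exists2 m : expr (tau x) (tau y), simple_matlang m & forall I nu,
    ent I m (nu x) (nu y) =
    \prod_(f <- fs | (x \in fac_vars f) && (y \in fac_vars f)) fac_sem I f nu.
Proof.
move=> + xy; elim: fs => [//|f fs IH] wf.
have {}IH := IH (fun f fi => wf f (or_intror fi)).
have [fxy _|nfxy] := boolP ((x \in fac_vars f) && (y \in fac_vars f));
    last first.
  rewrite /= (negPf nfxy) => /IH[m ms me].
  by exists m => // I nu; rewrite big_cons (negPf nfxy) me.
have [e es ee] : exists2 m : expr (tau x) (tau y), simple_matlang m &
    forall (I : instance K S) nu, ent I m (nu x) (nu y) = fac_sem I f nu.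
  have := wf f (or_introl erefl); move: fxy {wf}.
  case: f => [e|z e|z z' e] //=.
    by rewrite !inE => /andP[/eqP xz /eqP yz]; rewrite xz yz eqxx in xy.
  rewrite !inE => + [zz' es].
  case: (eqVneq x z) => [xz|xz] /=; case: (eqVneq y z') => [yz|yz] /=.
  - by move=> _; subst z z'; exists e.
  - rewrite orbF => /eqP yz'; rewrite xz yz' eqxx in xy.
    by [].
  - rewrite orbT andbT => /eqP xz'; rewrite xz' yz eqxx in xy.
    by [].
  - rewrite orbF => /andP[/eqP xz' /eqP yz']; subst z z'.
    by exists (ETr e); [exact: STr|move=> I nu; rewrite ent_tr].
have [/IH[m ms me]|nfs] := boolP (has (fun f =>
    (x \in fac_vars f) && (y \in fac_vars f)) fs); last first.
  exists e => // I nu; rewrite big_cons fxy ee.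
  by rewrite big_hasC ?mulr1.
exists (EHad e m); first exact: SHad.
by move=> I nu; rewrite ent_had big_cons fxy ee me.
Qed.

Definition co_occur (fs : seq factor) x y : Prop :=
  exists2 f, List.In f fs & (x \in fac_vars f) && (y \in fac_vars f).

Definition dominated (fs : seq factor) x y : Prop :=
  forall f, List.In f fs -> x \in fac_vars f -> y \in fac_vars f.

(** Domination is inclusion of the sets of factors and co-occurrence is their intersection being
    nonempty. The second clause combines both q-hierarchical conditions: a quantified variable that
    meets a head variable is dominated by it. *)
Definition hierarchical (h : seq nat) (fs : seq factor) : Prop :=
  (forall x y, x != y -> co_occur fs x y ->
     dominated fs x y \/ dominated fs y x) /\
  (forall x y, x \in h -> y \notin h -> co_occur fs x y -> dominated fs y x).

Lemma fac_vars_two f x y z : fac_wf f -> x != y ->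
  x \in fac_vars f -> y \in fac_vars f -> z \in fac_vars f -> z = x \/ z = y.
Proof.
case: f => [e|u e|u v e] //= _ xy; rewrite !inE.
  by move=> /eqP xu /eqP yu; rewrite xu yu eqxx in xy.
move=> /orP[]/eqP xE /orP[]/eqP yE; subst x y; rewrite ?eqxx// in xy;
  by move=> /orP[]/eqP->; auto.
Qed.

Lemma prod_without I y (fs : seq factor) nu d :
  \prod_(f <- fs) fac_sem I f (upd nu y d) =
  (\prod_(f <- fs | y \in fac_vars f) fac_sem I f (upd nu y d)) *
  \prod_(f <- [seq f <- fs | y \notin fac_vars f]) fac_sem I f nu.
Proof.
rewrite (bigID (fun f => y \in fac_vars f)) /= big_filter; congr (_ * _).
apply: eq_bigr => f yf; apply: fac_sem_depends_on => x xf.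
by rewrite upd_neq//; apply: contraNneq yf => <-.
Qed.

Definition eliminates (h : seq nat) y (fs fs' : seq factor) : Prop :=
  [/\ forall f, List.In f fs' -> fac_wf f,
      forall f x, List.In f fs' -> x \in fac_vars f ->
        x != y /\ exists2 g, List.In g fs & x \in fac_vars g,
      hierarchical h fs'
    & forall I nu, in_dims I tau nu ->
      \sum_(d < sdim I (tau y)) \prod_(f <- fs) fac_sem I f (upd nu y (psucc d))
      = \prod_(f <- fs') fac_sem I f nu].

(** The factors on [y] form one vector [u], whose sum is the scalar obtained from its transpose
    times the all-ones vector. If [y] is in no factor, this scalar counts the dimension of [y]. The
    other factors are kept, which preserves the hierarchy. *)
Lemma eliminate_isolated h y fs :
  (forall f, List.In f fs -> fac_wf f) -> hierarchical h fs ->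
  (forall f, List.In f fs -> y \in fac_vars f -> fac_vars f = [:: y]) ->
  exists fs', eliminates h y fs fs'.
Proof.
move=> wf [h1 h2] yfs; have [u us ue] := gather_unary y wf.
pose fs' := FacS (EMul (ETr u) (EOnes (tau y))) ::
  [seq f <- fs | y \notin fac_vars f].
exists fs'; split.
- move=> f [<-|/In_filter[/wf]//]; apply: SMulOnes; exact: STr.
- move=> f x [<-//|/In_filter[ffs yf] xf]; split; last by exists f.
  by apply: contraNneq yf => <-.
- have sub f z : List.In f fs' -> z \in fac_vars f -> List.In f fs.
    by case=> [<-//|/In_filter[]].
  have cosub x z : co_occur fs' x z -> co_occur fs x z.
    move=> [f ffs /andP[xf zf]]; exists f; last by rewrite xf.
    exact: sub xf.
  have domsub x z : dominated fs x z -> dominated fs' x z.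
    by move=> dxz f ffs xf; apply: dxz => //; exact: sub xf.
  split=> [x z xz /cosub /(h1 _ _ xz)[]/domsub|x z xh zh /cosub]; auto.
- move=> I nu nud; rewrite big_cons /= ent_mul_ones mulr1 big_distrl /=.
  apply: eq_bigr => d _; rewrite prod_without ent_tr; congr (_ * _).
  have := ue I (upd nu y (psucc d)); rewrite upd_eq => ->; last exact: ltn_ord.
  apply: big_In => // f ffs; apply/idP/eqP => [/(yfs _ ffs)//|->].
  by rewrite mem_head.
Qed.

(** Every factor on [y] also mentions [x], so all of them form one matrix [m] and summing over [y]
    replaces them by the vector of row sums of [m], a unary factor on [x]. *)
Lemma eliminate_leaf h x y fs :
  (forall f, List.In f fs -> fac_wf f) -> hierarchical h fs ->
  x != y -> co_occur fs x y -> dominated fs y x ->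
  exists fs', eliminates h y fs fs'.
Proof.
move=> wf [h1 h2] xy [f0 f0fs /andP[xf0 yf0]] dyx.
have [|m ms me] := gather_binary wf xy.
  by apply/has_In; exists f0 => //; rewrite xf0.
pose fs' := FacU (EMul m (EOnes (tau y))) :: [seq f <- fs | y \notin fac_vars f].
have co' u v : u != v -> co_occur fs' u v ->
    [/\ co_occur fs u v, u != y & v != y].
  move=> uv [f [<-|/In_filter[ffs yf]] /andP[]] /=.
    by rewrite !inE => /eqP ux /eqP vx; rewrite ux vx eqxx in uv.
  move=> uf vf; split; first by exists f => //; rewrite uf.
    by apply: contraNneq yf => <-.
  by apply: contraNneq yf => <-.
(* [f0] mentions only [x] and [y], so no other variable dominated [x], and
   replacing its star arm by a unary factor destroys no domination. *)
have dom' u v : u != v -> v != y -> dominated fs u v -> dominated fs' u v.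
  move=> uv vy duv f [<-|/In_filter[ffs _]] /=; last exact: duv.
  rewrite inE => /eqP ux; have := duv _ f0fs; rewrite ux => /(_ xf0) vf0.
  case: (fac_vars_two (wf _ f0fs) xy xf0 yf0 vf0) => [vx|vy'].
    by rewrite ux vx eqxx in uv.
  by rewrite vy' eqxx in vy.
exists fs'; split.
- by move=> f [<-|/In_filter[/wf]//]; exact: SMulOnes.
- move=> f z [<-|/In_filter[ffs yf] zf] /=.
    by rewrite inE => /eqP->; split=> //; exists f0.
  by split; [apply: contraNneq yf => <-|exists f].
- split=> [u v uv /(co' _ _ uv)[couv uy vy]|u v uh vh couv].
    by case: (h1 _ _ uv couv) => [/dom' H|/dom' H];
      [left; exact: H|right; apply: H; rewrite // eq_sym].
  have uv : u != v by apply: contraNneq vh => <-.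
  have [couv' uy vy] := co' _ _ uv couv.
  by apply: dom'; rewrite // 1?eq_sym//; exact: h2.
- move=> I nu nud; rewrite big_cons /= ent_mul_ones mulr1 big_distrl /=.
  apply: eq_bigr => d _; rewrite prod_without; congr (_ * _).
  have := me I (upd nu y (psucc d)); rewrite upd_eq upd_neq// => ->.
  apply: big_In => // f ffs; apply/idP/andP => [yf|[]//].
  by split=> //; exact: dyx.
Qed.

(** Any quantified [y0] leads to an eliminable variable: [y0] itself if it is isolated or dominated
    by a neighbour, and otherwise a neighbour [x] that [y0] dominates. *)
Lemma eliminate_all h ys fs :
  uniq ys -> (forall y, y \in ys -> y \notin h) ->
  (forall f, List.In f fs -> fac_wf f) ->
  (forall f x, List.In f fs -> x \in fac_vars f -> x \in h ++ ys) ->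
  hierarchical h fs ->
  exists fs', [/\ forall f, List.In f fs' -> fac_wf f,
      forall f x, List.In f fs' -> x \in fac_vars f -> x \in h,
      hierarchical h fs'
    & forall I nu, in_dims I tau nu ->
      tsum I tau ys (fun nu => \prod_(f <- fs) fac_sem I f nu) nu =
      \prod_(f <- fs') fac_sem I f nu].
Proof.
have [n] := ubnP (size ys); elim: n ys fs => // n IH [|y0 ys0] fs szn uys yh wf.
  by move=> vars hier; exists fs; split=> // f x /vars xv /xv; rewrite cats0.
set ys := y0 :: ys0 in szn uys yh * => vars hier.
have [y [fs1 [yys [wf1 vars1 hier1 sem1]]]] :
    exists y fs1, y \in ys /\ eliminates h y fs fs1.
  have [iso|] := pselect (forall f, List.In f fs -> y0 \in fac_vars f ->
      fac_vars f = [:: y0]).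
    have [fs1 el] := eliminate_isolated wf hier iso.
    by exists y0, fs1; rewrite mem_head.
  move=> /existsNP[f /not_implyP[ffs /not_implyP[y0f nf]]].
  have [x xf xy0] : exists2 x, x \in fac_vars f & x != y0.
    have := wf f ffs; move: y0f nf {ffs}.
    case: f => [e|z e|z z' e] //=; first by rewrite inE => /eqP->.
    rewrite !inE => /orP[]/eqP-> _ [zz' _].
      by exists z'; rewrite ?inE ?eqxx ?orbT // eq_sym.
    by exists z; rewrite ?inE ?eqxx.
  have cox : co_occur fs x y0 by exists f => //; rewrite xf.
  have cox' : co_occur fs y0 x by exists f => //; rewrite xf y0f.
  have [dy0|ndy0] := pselect (dominated fs y0 x).
    have [fs1 el] := eliminate_leaf wf hier xy0 cox dy0.
    by exists y0, fs1; rewrite mem_head.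
  have dx : dominated fs x y0 by case: (hier.1 _ _ xy0 cox).
  (* A head variable [x] would dominate the quantified [y0], which has just been excluded. *)
  have xys : x \in ys.
    have := vars _ _ ffs xf; rewrite mem_cat => /orP[xh|//].
    by case: ndy0; apply: hier.2 => //; apply: yh; rewrite mem_head.
  have [|fs1 el] := eliminate_leaf wf hier _ cox' dx; first by rewrite eq_sym.
  by exists x, fs1.
have [||||fs' [wf' vars' hier' sem']] := IH (rem y ys) fs1 _ _ _ wf1 _ hier1.
- by rewrite size_rem.
- exact: rem_uniq.
- by move=> z /mem_rem; exact: yh.
- move=> f x ffs xf; have [xy [g gfs xg]] := vars1 _ _ ffs xf.
  have := vars _ _ gfs xg; rewrite !mem_cat => /orP[->//|xys].
  by rewrite mem_rem_uniq// [_ \in predD1 _ _]inE /= xy xys orbT.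
exists fs'; split=> // I nu nud.
rewrite (tsum_rem _ _ _ _ uys yys) -sem'//.
by apply: eq_tsum_in => // mu mud; exact: sem1.
Qed.

Lemma prod_scalar fs : (forall f, List.In f fs -> fac_wf f) ->
  (forall f x, List.In f fs -> x \in fac_vars f -> False) ->
  exists2 c : expr sone sone, simple_matlang c & forall I nu,
    ent I c pone pone = \prod_(f <- fs) fac_sem I f nu.
Proof.
move=> wf vars; have [c cs ce] := gather_scalar wf; exists c => // I nu.
rewrite (ce I nu); apply: big_In => // f /vars; case: (fac_vars f) => // x s H.
by case: (H x); rewrite mem_head.
Qed.

Lemma prod_unary x fs : (forall f, List.In f fs -> fac_wf f) ->
  (forall f z, List.In f fs -> z \in fac_vars f -> z = x) ->
  exists2 u : expr (tau x) sone, simple_matlang u &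
    forall I nu, in_dims I tau nu ->
    ent I u (nu x) pone = \prod_(f <- fs) fac_sem I f nu.
Proof.
move=> wf vars; have [c cs ce] := gather_scalar wf.
have [u us ue] := gather_unary x wf.
exists (EScale c u); first exact: SScale.
move=> I nu nud; rewrite ent_scale (ce I nu) ue//.
rewrite [RHS](bigID (fun f => fac_vars f == [::])) /=; congr (_ * _).
apply: big_In => // f ffs; have := wf _ ffs; have := vars f ^~ ffs.
case: f {ffs} => [e|z e|z y e] //= H; first by move=> _; rewrite (H z) ?inE// eqxx.
case=> zy _; have := H y; have := H z; rewrite !inE !eqxx orbT.
by move=> /(_ isT) zx /(_ isT) yx; rewrite zx yx eqxx in zy.
Qed.

(** Without binary factors the product is an outer product of two vectors. With one, [x] and [y] are
    comparable; the dominated variable has no unary factor, so a single vector remains, beside the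
    matrix, and absorbs the scalar. *)
Lemma prod_binary x y fs : x != y -> (forall f, List.In f fs -> fac_wf f) ->
  (forall f z, List.In f fs -> z \in fac_vars f -> z \in [:: x; y]) ->
  hierarchical [:: x; y] fs ->
  exists2 e : expr (tau x) (tau y), qh_matlang e &
    forall I nu, in_dims I tau nu ->
    ent I e (nu x) (nu y) = \prod_(f <- fs) fac_sem I f nu.
Proof.
move=> xy wf vars [h1 _]; have [c cs ce] := gather_scalar wf.
have [u us ue] := gather_unary x wf; have [v vs ve] := gather_unary y wf.
set B := fun f => (x \in fac_vars f) && (y \in fac_vars f).
have split_prod I nu : \prod_(f <- fs) fac_sem I f nu =
  \prod_(f <- fs | fac_vars f == [::]) fac_sem I f nu *
  \prod_(f <- fs | fac_vars f == [:: x]) fac_sem I f nu *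
  \prod_(f <- fs | fac_vars f == [:: y]) fac_sem I f nu *
  \prod_(f <- fs | B f) fac_sem I f nu.
  rewrite [X in _ = X * _ * _ * _]big_mkcond [X in _ = _ * X * _ * _]big_mkcond.
  rewrite [X in _ = _ * _ * X * _]big_mkcond [X in _ = _ * _ * _ * X]big_mkcond.
  rewrite -!big_split /=; apply: big_In => // f ffs _.
  have := wf _ ffs; have := vars f ^~ ffs; rewrite /B.
  case: f {ffs} => [e|z e|z z' e] H /=.
  - by rewrite !mulr1.
  - move: (ent I e _ _) => w _; have := H z; rewrite !inE eqxx => /(_ isT).
    rewrite !eqseq_cons !andbT => /orP[]/eqP->; rewrite eqxx.
      by rewrite (negPf xy) eq_sym (negPf xy) andbF !mulr1 mul1r.
    by rewrite eq_sym (negPf xy) !mulr1 mul1r.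
  - case=> zz' _; rewrite !eqseq_cons !andbF !mul1r.
    have := H z; have := H z'; rewrite !inE !eqxx orbT => /(_ isT) + /(_ isT).
    move=> /orP[]/eqP z'E /orP[]/eqP zE; subst z z'; rewrite ?eqxx// in zz' *;
      by rewrite !orbT.
have scale I nu : in_dims I tau nu -> \prod_(f <- fs) fac_sem I f nu =
    ent I c pone pone * ent I u (nu x) pone * ent I v (nu y) pone *
    \prod_(f <- fs | B f) fac_sem I f nu.
  by move=> nud; rewrite split_prod (ce I nu) ue// ve.
have [hB|nB] := boolP (has B fs); last first.
  exists (EHad (EMul (EOnes (tau x)) (ETr v))
               (EMul (EScale c u) (ETr (EOnes (tau y))))).
    by apply: QBoth; [exact: STr|exact: SScale].
  move=> I nu nud; rewrite scale// big_hasC// mulr1.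
  rewrite ent_had ent_ones_mul ent_mul_ones_tr ent_tr ent_scale.
  by rewrite !nud mul1r mulr1 mulrC.
have none I nu z w : z != w -> dominated fs z w ->
    \prod_(f <- fs | fac_vars f == [:: z]) fac_sem I f nu = 1.
  move=> zw dzw; rewrite (@big_In _ _ _ _ _ _ pred0 _ (fun f => fac_sem I f nu)) ?big_pred0_eq//.
  move=> f ffs; apply/negP => /eqP fz; have := dzw _ ffs.
  by rewrite fz !inE eqxx eq_sym (negPf zw) => /(_ isT).
have [m ms me] := gather_binary wf xy hB.
have [|dxy|dyx] := h1 _ _ xy.
  exact/has_In.
- exists (EHad (EMul (EOnes (tau x)) (ETr (EScale c v))) m).
    by apply: QLeft => //; apply: STr; exact: SScale.
  move=> I nu nud; rewrite scale// ue// (none _ _ x y)// mulr1 -(me I nu).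
  by rewrite ent_had ent_ones_mul ent_tr ent_scale nud mul1r.
- exists (EHad m (EMul (EScale c u) (ETr (EOnes (tau y))))).
    by apply: QRight => //; exact: SScale.
  move=> I nu nud; rewrite scale// ve// (none _ _ y x) 1?eq_sym// mulr1 -(me I nu).
  by rewrite ent_had ent_mul_ones_tr ent_scale nud mulr1 mulrC.
Qed.

End Factors.

(** * From the atoms of a query to factors *)

Section FromQuery.

Context (K : comNzSemiRingType) (S : schema) (V : vocabulary).
Context (E : encoding S V) (tau : nat -> size_sym S).

Lemma expr_cast a b a' b' (e : expr a b) : simple_matlang e -> a = a' -> b = b' ->
  exists2 e' : expr a' b', simple_matlang e' &
    forall (I : instance K S) i j, ent I e' i j = ent I e i j.
Proof. by move=> es aa bb; subst a' b'; exists e. Qed.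

Lemma in_dims_sone (I : instance K S) nu x :
  in_dims I tau nu -> tau x = sone -> nu x = pone.
Proof.
by move=> nud tx; apply: posnat_le1; have := nud x; rewrite tx sdim_sone.
Qed.

(** A variable of type [sone] can only take the value [pone] within the dimensions, so its position
    is constant and the variable is dropped from the factor. *)
Lemma factor_entry a b (e : expr a b) x y : simple_matlang e ->
  tau x = a -> tau y = b ->
  exists f : factor tau, [/\ fac_wf f,
    forall z, z \in fac_vars f = (z \in [:: x; y]) && (tau z != sone)
  & forall (I : instance K S) nu, in_dims I tau nu ->
    ent I e (nu x) (nu y) = fac_sem I f nu].
Proof.
move=> es tx ty; subst a b.
have [x1|x1] := eqVneq (tau x) sone; have [y1|y1] := eqVneq (tau y) sone.
- have [e' es' ee] := expr_cast es x1 y1; exists (FacS tau e'); split=> //.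
    move=> z; rewrite !inE; case: eqP => [->|_]; first by rewrite x1 eqxx.
    by case: eqP => [->|_ //]; rewrite y1 eqxx.
  move=> I nu nud; rewrite /= ee.
  by rewrite (in_dims_sone nud x1) (in_dims_sone nud y1).
- have [e' es' ee] := expr_cast (STr es) erefl x1.
  exists (FacU e'); split=> //.
    move=> z; rewrite !inE; case: (eqVneq z y) => [->|_]; first by rewrite orbT.
    by rewrite orbF; case: eqP => // ->; rewrite x1 eqxx.
  by move=> I nu nud; rewrite /= ee ent_tr (in_dims_sone nud x1).
- have [e' es' ee] := expr_cast es erefl y1.
  exists (FacU e'); split=> //.
    move=> z; rewrite !inE; case: (eqVneq z x) => [->|_] //=.
    by case: eqP => // ->; rewrite y1 eqxx.
  by move=> I nu nud; rewrite /= ee (in_dims_sone nud y1).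
- have [xy|xy] := eqVneq x y.
    (* A repeated variable reads the diagonal; the row sums of the Hadamard product with the
       identity form the vector of diagonal entries. *)
    subst y; exists (FacU (EMul (EHad (EId (tau x)) e) (EOnes (tau x)))).
    split=> [|z|I nu nud] /=.
    + by apply: SMulOnes; apply: SHad => //; exact: SId.
    + by rewrite !inE orbb; case: eqP => // ->; rewrite x1.
    + rewrite ent_mul_ones mulr1.
      case: (posnatP (sdim I (tau x)) (nu x)) (nud x) => [i _ _|]; last first.
        by rewrite ltnNge => /negP.
      rewrite (bigD1 i)//= big1 ?addr0 => [|d di].
        by rewrite ent_had ent_id eqxx /= ltn_ord mul1r.
      rewrite ent_had ent_id; case: eqP => [[/ord_inj/eqP]|_].
        by rewrite eq_sym (negPf di).
      by rewrite andbF mul0r.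
  exists (FacB e); split=> // z; rewrite !inE.
  by case: eqP => [->|_] /=; [rewrite x1|case: eqP => // ->; rewrite y1].
Qed.

Lemma atom_factor a : atom_typed E (Some \o tau) a -> is_rel_atom a ->
  exists f : factor tau, [/\ fac_wf f,
    forall z, z \in fac_vars f = (z \in avars a) && (tau z != sone)
  & forall (I : instance K S) nu, in_dims I tau nu ->
    atom_sem (Rel E I) a nu = fac_sem I f nu].
Proof.
case: a => [R t|//]; rewrite [atom_typed _ _ _]/= => + _.
set A := mat_rel E R; case tE: (tval t) => [|x [|y [|]]] //.
- case=> r1 c1; have [e es ee] := expr_cast (SSym A) r1 c1.
  exists (FacS tau e); split=> // [z|I nu _].
    by rewrite -[_ \in avars _]/(z \in tval t) tE.
  by rewrite (atom_sem_Rel0 _ _ _ tE) /= ee.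
- move=> tx; have sem1 (I : instance K S) nu : in_dims I tau nu ->
      atom_sem (Rel E I) (ARel t) nu = if mcol A == sone
      then ent I (ESym A) (nu x) pone else ent I (ESym A) pone (nu x).
    by move=> _; exact: atom_sem_Rel1.
  have [e es ee] : exists2 e : expr (tau x) sone, simple_matlang e &
      forall (I : instance K S) nu, in_dims I tau nu ->
      atom_sem (Rel E I) (ARel t) nu = ent I e (nu x) pone.
    case: tx => -[s1 [tx]].
      have [e es ee] := expr_cast (SSym A) (esym tx) s1; exists e => // I nu nud.
      by rewrite sem1// ee; move/eqP: s1 => ->.
    have [e es ee] := expr_cast (STr (SSym A)) (esym tx) s1.
    exists e => // I nu nud; rewrite sem1// ee ent_tr.
    case: (mcol A =P sone) => // c1.
    by rewrite (in_dims_sone nud) // tx.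
  have [x1|x1] := eqVneq (tau x) sone.
    have [e' es' ee'] := expr_cast es x1 erefl.
    exists (FacS tau e'); split=> // [z|I nu nud].
      rewrite -[_ \in avars _]/(z \in tval t) tE /= !inE.
      by case: (z =P x) => // ->; rewrite x1 eqxx.
    by rewrite ee// /= ee' (in_dims_sone nud x1).
  exists (FacU e); split=> // z.
  rewrite -[_ \in avars _]/(z \in tval t) tE /= !inE.
  by case: eqP => // ->; rewrite x1.
- case=> -[tx] [ty]; have [f [wf vf sf]] := factor_entry (SSym A) tx ty.
  exists f; split=> // [z|I nu nud].
    by rewrite -[_ \in avars _]/(z \in tval t) tE vf.
  by rewrite (atom_sem_Rel2 _ _ _ tE) -sf.
Qed.

(** A well-typed comparison atom bounds its variable by the dimension of its own type, so it has
    value one within the dimensions and leaves no factor. Each factor is traced back to a relational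
    atom in order to transfer the hierarchy. *)
Lemma atoms_factors (s : seq (atom V)) :
  (forall a, List.In a s -> atom_typed E (Some \o tau) a) ->
  exists fs : seq (factor tau), [/\ forall f, List.In f fs -> fac_wf f,
    forall f, List.In f fs -> exists a, [/\ List.In a s, is_rel_atom a
      & forall z, z \in fac_vars f = (z \in avars a) && (tau z != sone)]
  & forall (I : instance K S) nu, in_dims I tau nu ->
    \prod_(a <- s) atom_sem (Rel E I) a nu = \prod_(f <- fs) fac_sem I f nu].
Proof.
elim: s => [|a s IH] ty.
  by exists [::]; split=> // I nu _; rewrite !big_nil.
have [fs [wf cor sem_]] := IH (fun b bs => ty b (or_intror bs)).
have ta := ty a (or_introl erefl).
have cor' f : List.In f fs -> exists b, [/\ List.In b (a :: s), is_rel_atom b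
    & forall z, z \in fac_vars f = (z \in avars b) && (tau z != sone)].
  by move=> /cor[b [bs rb vb]]; exists b; split=> //; right.
case ra: (is_rel_atom a).
  have [f [wff vf sf]] := atom_factor ta ra.
  exists (f :: fs); split=> [g [<-|/wf]//|g [<-|/cor']//|I nu nud].
    by exists a; split=> //; left.
  by rewrite !big_cons sem_// sf.
exists fs; split=> // I nu nud; rewrite big_cons sem_//.
case: a ta ra {ty cor'} => // x c [tx] _.
by rewrite atom_sem_Le -tx nud mul1r.
Qed.

Lemma q_hierarchical_factors k (Q : cq V k) (fs : seq (factor tau)) :
  q_hierarchical Q ->
  (forall f, List.In f fs -> exists a, [/\ List.In a (cq_body Q), is_rel_atom a
      & forall z, z \in fac_vars f = (z \in avars a) && (tau z != sone)]) ->
  hierarchical (cq_head Q) fs.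
Proof.
move=> [q1 q2] cor.
have common x y : co_occur fs x y -> exists a, [/\ atoms Q x a, atoms Q y a,
    tau x != sone & tau y != sone].
  move=> [f /cor[a [aQ ra vf]]]; rewrite !vf.
  by move=> /andP[/andP[xa tx] /andP[ya ty]]; exists a.
have sub x y : (atoms Q x `<=` atoms Q y)%classic -> tau y != sone ->
    dominated fs x y.
  move=> xy ty f /cor[a [aQ ra vf]]; rewrite !vf ty andbT => /andP[xa _].
  by have [] : atoms Q y a by exact: xy.
split=> [x y _ /common[a [ax ay tx ty]]|x y xh yh /common[a [ax ay tx ty]]].
  case: (q1 x y) => [xy|yx|]; [by left; exact: sub|by right; exact: sub|].
  by move=> /seteqP[/(_ a)]; case.
apply: sub => //; case: (q1 x y) => // [xy|].
  (* Otherwise the inclusion would be strict and the head condition would put [y] in the head; the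
     shared atom [a] shows that [x] occurs in a relational atom. *)
  apply: contrapT => nyx; move/negP: yh; apply.
  by apply: q2 xh _ _; [exists a|split].
by move=> /seteqP[/(_ a)]; case.
Qed.

(** The factors describe the query within the dimensions only; the second part says that it vanishes
    when a head variable lies outside. *)
Lemma cq_factors k (Q : cq V k) :
  (forall a, List.In a (cq_body Q) -> atom_typed E (Some \o tau) a) ->
  q_hierarchical Q ->
  (exists fs : seq (factor tau), [/\ forall f, List.In f fs -> fac_wf f,
    forall f x, List.In f fs -> x \in fac_vars f -> x \in cq_head Q,
    hierarchical (cq_head Q) fs
  & forall (I : instance K S) nu, in_dims I tau nu ->
    sem (Rel E I) (cq_formula Q) nu = \prod_(f <- fs) fac_sem I f nu]) /\
  (forall (I : instance K S) nu, sem (Rel E I) (cq_formula Q) nu != 0 ->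
    forall x, x \in cq_head Q -> (val (nu x) <= sdim I (tau x))%N).
Proof.
case: Q => h ys a s uys ysub hfree; rewrite /cq_formula /cq_body /= => ty qh.
have fconj_bound (I : instance K S) nu : sem (Rel E I) (fconj a s) nu != 0 ->
    forall y, y \in avars_of (a :: s) -> (val (nu y) <= sdim I (tau y))%N.
  rewrite sem_fconj => /prod_atom_sem_neq0 nz y /avars_ofP[b bs yb].
  exact: atom_typed_bound (ty b bs) (nz b bs) _ yb.
have semE (I : instance K S) nu : sem (Rel E I) (cq_formula_of ys a s) nu =
    tsum I tau ys (fun nu => \prod_(b <- a :: s) atom_sem (Rel E I) b nu) nu.
  rewrite /cq_formula_of (@sem_exists _ _ _ I tau)//.
    by apply: eq_tsum => mu; exact: sem_fconj.
  move=> mu /fconj_bound bnd y /ysub; rewrite fvars_fconj; exact: bnd.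
have memh x : x \in h = (x \notin ys) && (x \in avars_of (a :: s)).
  by rewrite hfree mem_fvars_ex fvars_fconj.
split; last first.
  move=> I nu; rewrite semE => /tsum_neq0[mu nz eqmu] x.
  rewrite memh => /andP[xys xs]; rewrite -eqmu//.
  by apply: fconj_bound xs; rewrite sem_fconj.
have [fs [wf cor sem_]] := @atoms_factors (a :: s) ty.
have [||||fs' [wf' vars' hier' sem']] := @eliminate_all K S tau h ys fs uys.
- by move=> y yys; rewrite memh yys.
- exact: wf.
- move=> f x /cor[b [bs rb vb]]; rewrite vb => /andP[xb _].
  rewrite mem_cat -[x \in tval h]/(x \in h) memh.
  have -> : x \in avars_of (a :: s) by apply/avars_ofP; exists b.
  by rewrite andbT; case: (x \in ys).
- exact: (q_hierarchical_factors qh cor).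
exists fs'; split=> // I nu nud; rewrite semE -sem'//.
by apply: eq_tsum_in => // mu mud; exact: sem_.
Qed.

(** Variables outside the head receive the default [pone], which lies in every dimension. *)
Lemma head_valuation_in_dims k (h : k.-tuple nat) (t : k.-tuple posnat)
    (I : instance K S) :
  (forall x, x \in h -> (val (head_valuation h t x) <= sdim I (tau x))%N) ->
  in_dims I tau (head_valuation h t).
Proof.
move=> hd x; case xh: (x \in h); first exact: hd.
rewrite /head_valuation nth_default; first exact: sdim_gt0.
by rewrite memNindex ?xh// !size_tuple.
Qed.

End FromQuery.

Lemma cq_qh_matlang (K : comNzSemiRingType) (S : schema) (V : vocabulary)
    (E : encoding S V) a b k (Q : cq V k) :
  arity_compat a b k -> q_hierarchical Q -> well_typed E a b Q ->
  exists2 e : expr a b, qh_matlang e & entry_simulates K E Q e.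
Proof.
move=> abk qh [tau0 + hty].
rewrite /cq_formula /cq_formula_of => /typed_foldr_ex[tau1 tau1Q tau01].
(* The default type only concerns variables that occur in no atom. *)
pose tau x := odflt sone (tau1 x).
have tauE x c : tau0 x = Some c -> tau x = c.
  by move=> /tau01; rewrite /tau => ->.
have ty c : List.In c (cq_body Q) -> atom_typed E (Some \o tau) c.
  move=> /(typed_fconj tau1Q); apply: atom_typedW => x d.
  by rewrite /tau /= => ->.
have [[fs [wf vars hier semE]] bnd] := @cq_factors K S V E tau k Q ty qh.
(* Outside the dimensions, both sides vanish. *)
have simI (e : expr a b) :
    (forall (I : instance K S) t, ~~ respects (cq_head Q) t ->
      ent I e (position a b t).1 (position a b t).2 = 0) ->
    (forall (I : instance K S) t, respects (cq_head Q) t ->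
      in_dims I tau (head_valuation (cq_head Q) t) ->
      ent I e (position a b t).1 (position a b t).2 =
      \prod_(f <- fs) fac_sem I f (head_valuation (cq_head Q) t)) ->
    (forall (I : instance K S) t, respects (cq_head Q) t ->
      ent I e (position a b t).1 (position a b t).2 != 0 ->
      forall x, x \in cq_head Q ->
        (val (head_valuation (cq_head Q) t x) <= sdim I (tau x))%N) ->
    entry_simulates K E Q e.
  move=> e0 eE ebnd I t; rewrite /cq_output; case: ifPn => [rt|/e0->//].
  have [ind|nind] := pselect (in_dims I tau (head_valuation (cq_head Q) t)).
    by rewrite semE// eE.
  transitivity (0 : K); last apply/esym; apply/eqP; apply: contrapT => /negP nz.
    by apply: nind; apply: head_valuation_in_dims; exact: bnd nz.
  by apply: nind; apply: head_valuation_in_dims; exact: ebnd nz.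
case: (cq_head Q) hier vars simI hty {bnd semE} => h.
case: h => [|x [|y [|]]] //= szh hier vars simI; move: (szh) => /eqP kE; subst k.
- case=> a1 b1; subst a b.
  have [|c cs ce] := prod_scalar K wf.
    by move=> f z ffs /(vars _ _ ffs).
  exists c; first exact: QSimple.
  apply: simI => [I t|I t _ _|I t _ _ x] //; first by rewrite respects_uniq.
  by rewrite -ce (tuple0 t).
- move=> hty; have [|u us ue] := prod_unary K (x := x) wf.
    by move=> f z ffs /(vars _ _ ffs); rewrite inE => /eqP.
  have headE (t : 1.-tuple posnat) i : tval t = [:: i] ->
      head_valuation (@Tuple 1 nat [:: x] szh) t x = i.
    by move=> tE; rewrite /head_valuation tE /= eqxx.
  (* The test follows [position], which reads a unary tuple as a column exactly when [b] is [sone];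
     if [a] is [sone] as well, the row and column typings coincide. *)
  have [b1|nb1] := eqVneq b sone.
    have ax : tau x = a.
      by case: hty => [[/tauE]//|[-> /tauE->]].
    subst a b; exists u; first exact: QSimple.
    apply: simI => [I t|I t _ ind|I t _]; first by rewrite respects_uniq.
      rewrite -ue//; case: t {ind} => -[|i [|? ?]] //= szt.
      by rewrite (headE _ i)// eqxx.
    case: t => -[|i [|? ?]] //= szt; rewrite eqxx => /ent_bound[+ _] z.
    by rewrite inE => + /eqP->; rewrite (headE _ i).
  have [a1 bx] : a = sone /\ tau x = b.
    by case: hty => [[_ b1]|[-> /tauE]//]; rewrite b1 eqxx in nb1.
  subst a b; exists (ETr u); first by apply: QSimple; exact: STr.
  apply: simI => [I t|I t _ ind|I t _]; first by rewrite respects_uniq.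
    rewrite -ue// ent_tr; case: t {ind} => -[|i [|? ?]] //= szt.
    by rewrite (headE _ i)// (negPf nb1).
  case: t => -[|i [|? ?]] //= szt; rewrite (negPf nb1) => /ent_bound[_ +] z.
  by rewrite inE => + /eqP->; rewrite (headE _ i).
- case=> /tauE ax /tauE by_; subst a b; have [xy|xy] := eqVneq x y.
    subst y; have [|u us ue] := prod_unary K (x := x) wf.
      by move=> f z ffs /(vars _ _ ffs); rewrite !inE orbb => /eqP.
    (* The diagonal matrix of [u]: its entries are copied along each row, then masked by the
       identity. *)
    exists (EHad (EId (tau x)) (EMul u (ETr (EOnes (tau x))))).
      by apply: QRight => //; exact: SId.
    have headE (t : 2.-tuple posnat) i j : tval t = [:: i; j] ->
        head_valuation (@Tuple 2 nat [:: x; x] szh) t x = i.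
      by move=> tE; rewrite /head_valuation tE /= eqxx.
    apply: simI => [I t|I t|I t].
    + case tE: (tval t) => [|i [|j [|? ?]]] //=; try by have := size_tuple t; rewrite tE.
      rewrite (respects_diag (x := x) (i := i) (j := j))// => ij.
      by rewrite ent_had ent_id (negPf ij) andbF mul0r.
    + case tE: (tval t) => [|i [|j [|? ?]]] //=; try by have := size_tuple t; rewrite tE.
      rewrite (respects_diag (x := x) (i := i) (j := j))// => /eqP ij ind.
      rewrite -ue// (headE _ i j)// -ij ent_had ent_id ent_mul_ones_tr eqxx.
      by have := ind x; rewrite (headE _ i j)// => ->; rewrite mul1r mulr1.
    + case tE: (tval t) => [|i [|j [|? ?]]] //=; try by have := size_tuple t; rewrite tE.
      move=> _ /ent_bound[ib _] z; rewrite !inE orbb => /eqP->.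
      by rewrite (headE _ i j).
  have [e eq ee] := prod_binary K xy wf vars hier.
  exists e => //.
  have headE (t : 2.-tuple posnat) i j : tval t = [:: i; j] ->
      head_valuation (@Tuple 2 nat [:: x; y] szh) t x = i /\
      head_valuation (@Tuple 2 nat [:: x; y] szh) t y = j.
    by move=> tE; rewrite /head_valuation tE /= !eqxx (negPf xy).
  have uxy : uniq (@Tuple 2 nat [:: x; y] szh) by rewrite /= inE xy.
  apply: simI => [I t|I t _|I t _]; first by rewrite respects_uniq.
    case tE: (tval t) => [|i [|j [|? ?]]] //=; try by have := size_tuple t; rewrite tE.
    by move=> ind; rewrite -ee//; have [-> ->] := headE _ _ _ tE.
  case tE: (tval t) => [|i [|j [|? ?]]] //=; try by have := size_tuple t; rewrite tE.
  move=> /ent_bound[ib jb] z; have [hx hy] := headE _ _ _ tE.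
  by rewrite !inE => /orP[]/eqP->; rewrite ?hx ?hy.
Qed.

Theorem theorem9 (K : comNzSemiRingType) :
  (forall (S : schema) (a b : size_sym S) (e : expr a b), qh_matlang e ->
   forall (V : vocabulary) (k : nat) (E : encoding S V)
     (abk : arity_compat a b k),
   exists Q : cq V k,
     [/\ binary Q, q_hierarchical Q, cq_simulates K E abk Q e
       & well_typed E a b Q]) /\
  (forall (V : vocabulary) (k : nat) (Q : cq V k), binary Q ->
   q_hierarchical Q ->
   forall (S : schema) (a b : size_sym S) (E : encoding S V)
     (abk : arity_compat a b k),
   well_typed E a b Q ->
   exists2 e : expr a b, qh_matlang e & expr_simulates K E abk e Q).
Proof.
split=> [S a b e qh V k E abk|V k Q _ qh S a b E abk wt].
  have [Q [bQ qQ sQ wQ]] := qh_matlang_cq K E abk qh.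
  by exists Q; split=> //; exact: entry_cq_simulates.
have [e eqh es] := cq_qh_matlang K abk qh wt.
by exists e => //; exact: entry_expr_simulates.
Qed.
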